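(* Let $d\ge1$ and let $S$ be a non-empty subset of $\{1,\dots,d\}$. The Markov trace $\{\widetilde\rho_{S,n}\}_{n\ge1}$ on $\{k_SY_{d,n}\}_{n\ge1}$ is given by $$\widetilde\rho_{S,n}(x)=\sum_{\mu\in\operatorname{Comp}_d(n)}\alpha_{[\mu]}\,(\tau_{\mu_1}\otimes\dots\otimes\tau_{\mu_d})\circ\operatorname{Tr}_{\operatorname{Mat}_{m_\mu}}\circ\Psi_\mu(E_\mu x)\qquad(n\ge1,\ x\in k_SY_{d,n})$$ for the following choice of parameters $\alpha_{\mu^0}$, $\mu^0\in\operatorname{Comp}^0_d$: $$\alpha_{\mu^0}=\begin{cases}0&\text{if }\mu^0_a>0\text{ for some }a\notin S,\\[0.4em]\dfrac{D_S^{|\mu^0|-1}}{|S|^{|\mu^0|}}&\text{otherwise.}\end{cases}$$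
   Context: Let $\xi_1,\dots,\xi_d$ be the $d$-th roots of unity in $\mathbb C$, $q,z$ indeterminates, $k=\mathbb C(\sqrt q,z)$. Permutations are multiplied as functions and $s_i=(i,i+1)$. Algebra $\widetilde Y_{d,n}$: unital algebra over $\mathbb C[q,q^{-1}]$ with generators $G_1,\dots,G_{n-1},t_1,\dots,t_n$ and relations $G_iG_j=G_jG_i$ ($|i-j|>1$), $G_iG_{i+1}G_i=G_{i+1}G_iG_{i+1}$, $t_it_j=t_jt_i$, $G_it_j=t_{s_i(j)}G_i$, $t_j^d=1$, $G_i^2=1+(q-1)e_i+(q-1)e_iG_i$, where $e_i=\frac1d\sum_{s=0}^{d-1}t_i^st_{i+1}^{-s}$; $\widetilde Y_{d,n}\subset\widetilde Y_{d,n+1}$ naturally. Set $c_b=\frac1{|S|}\sum_{a\in S}\xi_a^b$ for $b=0,\dots,d-1$, and let $\operatorname{tr}_S$ be the unique (by a theorem of Juyumaya) $k$-linear function on the chain of algebras $k\widetilde Y_{d,n}$ with values in $k$ satisfying: $\operatorname{tr}_S(1)=1$; $\operatorname{tr}_S(xy)=\operatorname{tr}_S(yx)$ for $x,y\in\widetilde Y_{d,n}$, $n\ge1$; $\operatorname{tr}_S(xG_n)=z\operatorname{tr}_S(x)$ for $x\in\widetilde Y_{d,n}$, $n\ge1$; $\operatorname{tr}_S(xt_{n+1}^b)=c_b\operatorname{tr}_S(x)$ for $x\in\widetilde Y_{d,n}$, $n\ge0$, $0\le b\le d-1$. Set $$E_S=\frac1{|S|},\quad\lambda_S=\frac{z+(1-q)E_S}{qz},\quad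 D_S=\frac1{\sqrt{\lambda_S}\,z},$$ and let $k_S$ be the field $k$ extended by an element $\sqrt{\lambda_S}$. Define $\widetilde\rho_{S,n}:k_S\widetilde Y_{d,n}\to k_S$ by $\widetilde\rho_{S,n}(x)=D_S^{n-1}\operatorname{tr}_S(x)$. Put $u=\sqrt q\sqrt{\lambda_S}$, $v=(q-1)\sqrt{\lambda_S}$ in $k_S$. $k_SY_{d,n}$ is the unital $k_S$-algebra with generators $g_1,\dots,g_{n-1},t_1,\dots,t_n$ and relations $g_ig_j=g_jg_i$ ($|i-j|>1$), $g_ig_{i+1}g_i=g_{i+1}g_ig_{i+1}$, $t_it_j=t_jt_i$, $g_it_j=t_{s_i(j)}g_i$, $t_j^d=1$, $g_i^2=u^2+v\,e_ig_i$. It is identified with $k_S\widetilde Y_{d,n}$ via $g_i=\sqrt{\lambda_S}(\sqrt q+(1-\sqrt q)e_i)G_i$, $t_j=t_j$; via this identification $\widetilde\rho_{S,n}$ is a linear map on $k_SY_{d,n}$, and $\{\widetilde\rho_{S,n}\}_{n\ge1}$ is a Markov trace, i.e. $\widetilde\rho_{S,n}(xy)=\widetilde\rho_{S,n}(yx)$ and $\widetilde\rho_{S,n+1}(xg_n^{\pm1})=\widetilde\rho_{S,n}(x)$ for $x,y\in k_SY_{d,n}$. For $w=s_{i_1}\cdots s_{i_r}$ reduced, $\tilde g_w=u^{-r}g_{i_1}\cdots g_{i_r}$. Hecke algebras: all over $k_S$ with $u=\sqrt q\sqrt{\lambda_S}$ and $v=(q-1)\sqrt{\lambda_S}$: $\mathcal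 H_n$ has generators $T_1,\dots,T_{n-1}$ and relations $T_iT_j=T_jT_i$ ($|i-j|>1$), $T_iT_{i+1}T_i=T_{i+1}T_iT_{i+1}$, $T_i^2=u^2+vT_i$; $\mathcal H_0=k_S$; $\tilde T_w=u^{-r}T_{i_1}\cdots T_{i_r}$ for $w=s_{i_1}\cdots s_{i_r}$ reduced. $\{\tau_n\}_{n\ge1}$ is the unique family of linear maps $\mathcal H_n\to k_S$ with $\tau_1(1)=1$, $\tau_n(xy)=\tau_n(yx)$, $\tau_{n+1}(xT_n^{\pm1})=\tau_n(x)$ for $x,y\in\mathcal H_n$; $\tau_0=\mathrm{id}$. Compositions: $\operatorname{Comp}_d(n)$ is the set of $d$-tuples of non-negative integers with sum $n$; $|\mu|$ is the sum of the parts; $[\mu]_a=1$ if $\mu_a\ge1$ and $0$ otherwise; $\operatorname{Comp}^0_d$ is the set of non-zero $d$-tuples with entries in $\{0,1\}$. $\mathfrak S^\mu\subset\mathfrak S_n$ is the Young subgroup acting on consecutive blocks of sizes $\mu_1,\dots,\mu_d$; $\mathcal H^\mu\subset\mathcal H_n$ is the subalgebra generated by the $T_i$ with $s_i\in\mathfrak S^\mu$, identified with $\mathcal H_{\mu_1}\otimes\dots\otimes\mathcal H_{\mu_d}$; $m_\mu=n!/(\mu_1!\cdots\mu_d!)$. Characters: for a character $\chi$ of $(\mathbb Z/d\mathbb Z)^n=\langle t_1,\dots,t_n\rangle$, $E_\chi=\prod_{i=1}^n\bigl(\frac1d\sum_{s=0}^{d-1}\chi(t_i)^st_i^{-s}\bigr)$;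 $w(\chi)(t_i)=\chi(t_{w^{-1}(i)})$; $\operatorname{Comp}(\chi)=\mu$ with $\mu_a=\#\{j:\chi(t_j)=\xi_a\}$; $E_\mu=\sum_{\operatorname{Comp}(\chi)=\mu}E_\chi$. $\chi_1^\mu$ takes value $\xi_1$ on the first $\mu_1$ of the $t_j$'s, $\xi_2$ on the next $\mu_2$, etc.; $\pi_{1,\mu}=1,\dots,\pi_{m_\mu,\mu}$ are the minimal length representatives of $\mathfrak S_n/\mathfrak S^\mu$; $\chi_k^\mu=\pi_{k,\mu}(\chi_1^\mu)$. $\Psi_\mu:E_\mu k_SY_{d,n}\to\operatorname{Mat}_{m_\mu}(\mathcal H^\mu)$ is the algebra isomorphism given on the basis $\{E_{\chi_k^\mu}\tilde g_w\}$ by $\Psi_\mu(E_{\chi_k^\mu}\tilde g_w)=\tilde T_{\pi_{k,\mu}^{-1}w\pi_{j,\mu}}\mathrm M_{k,j}$, where $w(\chi_j^\mu)=\chi_k^\mu$ and $\mathrm M_{k,j}$ is the elementary matrix. $\operatorname{Tr}_{\operatorname{Mat}_{m_\mu}}$ is the sum of diagonal entries. *)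

(* Defs.v *)
From HB Require Import structures.
From mathcomp Require Import all_boot all_order all_fingroup all_algebra all_field.
From mathcomp Require Import generic_quotient boolp reals complex zify ring.

Set Implicit Arguments.
Unset Strict Implicit.
Unset Printing Implicit Defensive.

Import GRing.Theory.
Local Open Scope ring_scope.
Local Open Scope quotient_scope.

(* Unital associative algebras given by generators and relations: formal
   expressions are identified when they take the same value in every algebra
   in which the relations hold.  [pres_sat] says that the relations can be
   satisfied in a non-zero algebra, so that [palg] is a (non-zero) [algType].
   [pliftm], [plift_gen] and [plift_uniq] are the universal property; that the
   generators satisfy the relations is [YtildeP], [YHP] and [HeckeP]. *)

Section Presentation.
Variables (K : fieldType) (X : Type).

Record presentation := Presentation {
  pres_rel : forall A : algType K, (X -> A) -> Prop;
  pres_sat : exists (A : algType K) (f : X -> A), pres_rel f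
}.

Inductive pterm :=
  | PGen of X | PCst of K | PAdd of pterm & pterm | PMul of pterm & pterm.

Fixpoint peval (A : algType K) (f : X -> A) (p : pterm) : A :=
  match p with
  | PGen x => f x
  | PCst c => c%:A
  | PAdd p1 p2 => peval f p1 + peval f p2
  | PMul p1 p2 => peval f p1 * peval f p2
  end.

HB.instance Definition _ := gen_eqMixin pterm.
HB.instance Definition _ := gen_choiceMixin pterm.

Variable P : presentation.

Definition peqv : rel pterm := fun p1 p2 =>
  `[< forall (A : algType K) (f : X -> A),
        pres_rel P f -> peval f p1 = peval f p2 >].

Lemma peqv_refl : reflexive peqv. Proof. by move=> p; apply/asboolP. Qed.

Lemma peqv_sym : symmetric peqv.
Proof.
by move=> p1 p2; apply/asboolP/asboolP => H A f Pf; rewrite (H A f Pf).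
Qed.

Lemma peqv_trans : transitive peqv.
Proof.
move=> p2 p1 p3 /asboolP H1 /asboolP H2.
by apply/asboolP => A f Pf; rewrite (H1 A f Pf) (H2 A f Pf).
Qed.

Canonical peqv_equiv := EquivRel peqv peqv_refl peqv_sym peqv_trans.

Definition palg := {eq_quot peqv}.
HB.instance Definition _ := EqQuotient.on palg.
HB.instance Definition _ := Choice.on palg.

Definition pclass (p : pterm) : palg := \pi_palg p.

Lemma pclassP p1 p2 :
  pclass p1 = pclass p2 <->
  (forall (A : algType K) (f : X -> A),
     pres_rel P f -> peval f p1 = peval f p2).
Proof. by split=> [/eqmodP/asboolP //|H]; apply/eqmodP/asboolP. Qed.

Lemma pclassK x : pclass (repr x) = x. Proof. exact: reprK. Qed.

Lemma peval_repr (A : algType K) (f : X -> A) p :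
  pres_rel P f -> peval f (repr (pclass p)) = peval f p.
Proof. by move: A f; apply/pclassP; rewrite pclassK. Qed.

Definition palg_add (x y : palg) := pclass (PAdd (repr x) (repr y)).
Definition palg_mul (x y : palg) := pclass (PMul (repr x) (repr y)).
Definition palg_opp (x : palg) := pclass (PMul (PCst (-1)) (repr x)).
Definition palg_scale (c : K) (x : palg) := pclass (PMul (PCst c) (repr x)).

Local Ltac palg_tac tac :=
  rewrite ?/palg_add ?/palg_mul ?/palg_opp ?/palg_scale;
  apply/pclassP => A f Pf /=; rewrite ?peval_repr //=; tac.

Lemma palg_addA : associative palg_add.
Proof. by move=> x y z; palg_tac ltac:(rewrite addrA). Qed.

Lemma palg_addC : commutative palg_add.
Proof. by move=> x y; palg_tac ltac:(rewrite addrC). Qed.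

Lemma palg_add0 : left_id (pclass (PCst 0)) palg_add.
Proof.
by move=> x; rewrite -[RHS]pclassK; palg_tac ltac:(rewrite scale0r add0r).
Qed.

Lemma palg_addN : left_inverse (pclass (PCst 0)) palg_opp palg_add.
Proof.
by move=> x; palg_tac ltac:(rewrite scaleN1r mulN1r addNr scale0r).
Qed.

HB.instance Definition _ :=
  GRing.isZmodule.Build palg palg_addA palg_addC palg_add0 palg_addN.

Lemma palg_mulA : associative palg_mul.
Proof. by move=> x y z; palg_tac ltac:(rewrite mulrA). Qed.

Lemma palg_mul1 : left_id (pclass (PCst 1)) palg_mul.
Proof.
by move=> x; rewrite -[RHS]pclassK; palg_tac ltac:(rewrite scale1r mul1r).
Qed.

Lemma palg_1mul : right_id (pclass (PCst 1)) palg_mul.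
Proof.
by move=> x; rewrite -[RHS]pclassK; palg_tac ltac:(rewrite scale1r mulr1).
Qed.

Lemma palg_mulDl : left_distributive palg_mul +%R.
Proof. by move=> x y z; palg_tac ltac:(rewrite mulrDl). Qed.

Lemma palg_mulDr : right_distributive palg_mul +%R.
Proof. by move=> x y z; palg_tac ltac:(rewrite mulrDr). Qed.

Lemma palg_1neq0 : pclass (PCst 1) != 0.
Proof.
apply/eqP => /pclassP E; have [A [f /E /=]] := pres_sat P.
by rewrite scale1r scale0r => /eqP; rewrite oner_eq0.
Qed.

HB.instance Definition _ :=
  GRing.Zmodule_isNzRing.Build palg
    palg_mulA palg_mul1 palg_1mul palg_mulDl palg_mulDr palg_1neq0.

Lemma palg_scaleA a b x : palg_scale a (palg_scale b x) = palg_scale (a * b) x.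
Proof.
by palg_tac ltac:(rewrite !mulr_algl scalerA).
Qed.

Lemma palg_scale1 : left_id 1 palg_scale.
Proof.
by move=> x; rewrite -[RHS]pclassK; palg_tac ltac:(rewrite scale1r mul1r).
Qed.

Lemma palg_scaleDr : right_distributive palg_scale +%R.
Proof. by move=> a x y; palg_tac ltac:(rewrite mulrDr). Qed.

Lemma palg_scaleDl x : {morph palg_scale^~ x : a b / a + b}.
Proof. by move=> a b; palg_tac ltac:(rewrite scalerDl mulrDl). Qed.

HB.instance Definition _ :=
  GRing.Zmodule_isLmodule.Build K palg
    palg_scaleA palg_scale1 palg_scaleDr palg_scaleDl.

Lemma palg_scaleAl (a : K) (x y : palg) : a *: (x * y) = (a *: x) * y.
Proof. by palg_tac ltac:(rewrite mulrA). Qed.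

HB.instance Definition _ := GRing.Lmodule_isLalgebra.Build K palg palg_scaleAl.

Lemma palg_scaleAr (a : K) (x y : palg) : a *: (x * y) = x * (a *: y).
Proof. by palg_tac ltac:(rewrite !mulr_algl scalerAr). Qed.

HB.instance Definition _ := GRing.Lalgebra_isAlgebra.Build K palg palg_scaleAr.

Definition pgen (x : X) : palg := pclass (PGen x).

(* The algebra morphism extending [f], when [f] satisfies the relations. *)
Definition plift (A : algType K) (f : X -> A) (x : palg) : A :=
  peval f (repr x).

Lemma plift_gen (A : algType K) (f : X -> A) x :
  pres_rel P f -> plift f (pgen x) = f x.
Proof. by move=> Pf; rewrite /plift peval_repr. Qed.

Lemma plift_morph (A : algType K) (f : X -> A) :
  pres_rel P f ->
  [/\ linear (plift f), plift f 1 = 1 & {morph plift f : x y / x * y}].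
Proof.
move=> Pf; split=> [c x y||x y]; rewrite /plift.
- by rewrite peval_repr //= peval_repr //= mulr_algl.
- by rewrite peval_repr //= scale1r.
- by rewrite peval_repr.
Qed.

Definition pliftm (A : algType K) (f : X -> A) of pres_rel P f := plift f.

Section PLiftMorphism.
Variables (A : algType K) (f : X -> A) (Pf : pres_rel P f).

Let pliftm_linear : linear (pliftm Pf). Proof. by have [] := plift_morph Pf. Qed.
Let pliftm_monoid : monoid_morphism (pliftm Pf).
Proof. by have [] := plift_morph Pf. Qed.

HB.instance Definition _ :=
  GRing.isLinear.Build K palg A *:%R (pliftm Pf) pliftm_linear.
HB.instance Definition _ :=
  GRing.isMonoidMorphism.Build palg A (pliftm Pf) pliftm_monoid.

Lemma pliftm_gen x : pliftm Pf (pgen x) = f x. Proof. exact: plift_gen. Qed.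

End PLiftMorphism.

Lemma palg_eqP (x y : palg) :
  (forall (A : algType K) (f : X -> A) (Pf : pres_rel P f),
     pliftm Pf x = pliftm Pf y) -> x = y.
Proof.
move=> E; rewrite -[x]pclassK -[y]pclassK; apply/pclassP => A f Pf.
exact: E Pf.
Qed.

Lemma peval_gen p : peval pgen p = pclass p.
Proof.
elim: p => //= [c|p1 -> p2 ->|p1 -> p2 ->]; apply/pclassP => A f Pf /=.
- by rewrite peval_repr //= scale1r mulr1.
- by rewrite !peval_repr.
- by rewrite !peval_repr.
Qed.

Lemma plift_uniq (A : algType K) (h h' : palg -> A) :
  linear h -> linear h' -> h 1 = 1 -> h' 1 = 1 ->
  {morph h : x y / x * y} -> {morph h' : x y / x * y} ->
  (forall x, h (pgen x) = h' (pgen x)) -> h =1 h'.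
Proof.
move=> lh lh' h1 h1' hM hM' hg x.
have hD (k : palg -> A) : linear k -> {morph k : x y / x + y}.
  by move=> lk a b; rewrite -[a]scale1r lk !scale1r.
have hZ (k : palg -> A) : linear k -> forall c, k c%:A = c *: k 1.
  move=> lk c; have k0 : k 0 = 0.
    by apply: (addrI (k 0)); rewrite -hD // !addr0.
  by rewrite -[c%:A]addr0 lk k0 addr0.
rewrite -[x]pclassK -peval_gen.
elim: (repr x) => //= [c|p1 IH1 p2 IH2|p1 IH1 p2 IH2].
- by rewrite !hZ // h1 h1'.
- by rewrite !hD // IH1 IH2.
- by rewrite hM hM' IH1 IH2.
Qed.

End Presentation.

Section GeneratedSubalgebra.
Variables (K : fieldType) (A : algType K) (G : A -> Prop).

Inductive in_subalg : A -> Prop :=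
  | sa_gen x of G x : in_subalg x
  | sa_one : in_subalg 1
  | sa_add x y of in_subalg x & in_subalg y : in_subalg (x + y)
  | sa_mul x y of in_subalg x & in_subalg y : in_subalg (x * y)
  | sa_scale c x of in_subalg x : in_subalg (c *: x).

Definition subalg_pred : {pred A} := fun x => `[< in_subalg x >].

Lemma subalg_pred_closed : subalg_closed subalg_pred.
Proof.
split=> [|c x y|x y]; rewrite !unfold_in.
- by apply/asboolP/sa_one.
- by move=> /asboolP ? /asboolP ?; apply/asboolP/sa_add => //; apply: sa_scale.
- by move=> /asboolP ? /asboolP ?; apply/asboolP/sa_mul.
Qed.

HB.instance Definition _ :=
  GRing.isSubalgClosed.Build K A subalg_pred subalg_pred_closed.

Record subalg := Subalg { subalg_val : A; _ : subalg_val \in subalg_pred }.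
HB.instance Definition _ := [isSub for subalg_val].
HB.instance Definition _ := [Choice of subalg by <:].
HB.instance Definition _ := [SubChoice_isSubAlgebra of subalg by <:].

End GeneratedSubalgebra.

Lemma quadratic_witness (K : fieldType) (a b : K) :
  exists M : 'M[K]_2, M ^+ 2 = a%:A + b *: M.
Proof.
exists (\matrix_(i, j) (if i == 0 then if j == 0 then 0 else a
                        else if j == 0 then 1 else b)).
apply/matrixP => i j; rewrite expr2 -mulmxE !mxE big_ord_recl big_ord1 !mxE.
case: i => [[|[|[]]] //= ?]; case: j => [[|[|[]]] //= ?] /=;
  rewrite ?mxE /= ?mulr1n ?mulr0n; ring.
Qed.

(* Positions, letters and blocks are numbered from 0. *)

Section SymmetricGroup.
Variable n : nat.
Implicit Types (i : 'I_n.-1) (w p : 'S_n).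

Lemma si_hi_subproof i : (i.+1 < n)%N.
Proof. by move: (ltn_ord i); lia. Qed.

(* [sadj i] exchanges [lo i] and [hi i]. *)
Definition lo i : 'I_n := widen_ord (leq_pred n) i.
Definition hi i : 'I_n := Ordinal (si_hi_subproof i).
Definition sadj i : 'S_n := tperm (lo i) (hi i).

(* Product of permutations as functions: [pcomp w p j = w (p j)]. *)
Definition pcomp w p : 'S_n := (p * w)%g.

Definition wprod (s : seq 'I_n.-1) : 'S_n :=
  foldr (fun i w => pcomp (sadj i) w) 1%g s.

Lemma wprod_cat s1 s2 : wprod (s1 ++ s2) = pcomp (wprod s1) (wprod s2).
Proof.
by elim: s1 => [|i s1 IH] /=; rewrite /pcomp ?mulg1 // IH /pcomp mulgA.
Qed.

Lemma wprod_tperm (x y : 'I_n) : exists s, wprod s = tperm x y.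
Proof.
wlog lt_xy : x y / (x < y)%N.
  move=> W; case: (ltngtP x y) => [/W //|/W [s Es]|/val_inj ->].
    by exists s; rewrite Es tpermC.
  by exists [::]; rewrite tperm1.
move eqk : (y - x).-1%N => k; elim: k y lt_xy eqk => [|k IH] y lt_xy eqk.
  have lt_x : (x < n.-1)%N.
    by move: (ltn_ord y) lt_xy; lia.
  exists [:: Ordinal lt_x]; rewrite /= /pcomp mul1g /sadj; congr tperm.
    exact: val_inj.
  apply: val_inj => /=; move: eqk lt_xy; lia.
have y_gt0 : (0 < y)%N by apply: leq_ltn_trans lt_xy.
have lt_y : (y.-1 < n.-1)%N by move: (ltn_ord y); lia.
pose i := Ordinal lt_y.
have hi_i : hi i = y by apply: val_inj => /=; rewrite prednK.
have [|/=|s Es] := IH (lo i); try by move: eqk lt_xy => /=; lia.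
exists (i :: s ++ [:: i]); rewrite /= wprod_cat /= /pcomp Es mul1g.
have -> : (sadj i * tperm x (lo i) * sadj i = tperm x (lo i) ^ sadj i)%g.
  by rewrite conjgE {3}/sadj tpermV mulgA.
rewrite tpermJ tpermL hi_i tpermD //; apply/eqP => /(congr1 val) /=;
  move: eqk lt_xy; lia.
Qed.

Lemma wprod_surj w : exists s, wprod s = w.
Proof.
have [ts -> _] := prod_tpermP w.
elim/big_ind: _ => [|p1 p2 [s1 <-] [s2 <-]|t _]; first by exists [::].
  by exists (s2 ++ s1); rewrite wprod_cat.
exact: wprod_tperm.
Qed.

Lemma len_subproof w : exists r, `[< exists2 s, wprod s = w & size s = r >].
Proof. by have [s Es] := wprod_surj w; exists (size s); apply/asboolP; exists s. Qed.

(* Coxeter length *)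
Definition len w : nat := ex_minn (len_subproof w).

Definition reduced_word w s : Prop := wprod s = w /\ size s = len w.

End SymmetricGroup.

Section YokonumaHecke.
Variables (K : fieldType) (d n : nat).

Section Relations.
Variables (A : algType K) (g : 'I_n.-1 -> A) (t : 'I_n -> A).

Definition braid_rel : Prop :=
  (forall i j : 'I_n.-1,
     (i.+1 < j)%N || (j.+1 < i)%N -> g i * g j = g j * g i) /\
  (forall i j : 'I_n.-1, j = i.+1 :> nat -> g i * g j * g i = g j * g i * g j).

Definition framed_braid_rel : Prop :=
  [/\ braid_rel,
      forall i j, t i * t j = t j * t i,
      forall i j, g i * t j = t (sadj i j) * g i
    & forall j, t j ^+ d = 1].

(* Here and in [E_char], the power t^{-s} (0 <= s < d) is written t^{d-s},
   as t^d = 1. *)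
Definition e_idem (i : 'I_n.-1) : A :=
  d%:R^-1 *: \sum_(s < d) t (lo i) ^+ s * t (hi i) ^+ (d - s).

Definition YtildeA_rel (q : K) : Prop :=
  framed_braid_rel /\
  forall i, g i ^+ 2 = 1 + (q - 1) *: e_idem i + (q - 1) *: (e_idem i * g i).

Definition YA_rel (u v : K) : Prop :=
  framed_braid_rel /\
  forall i, g i ^+ 2 = (u ^+ 2)%:A + v *: (e_idem i * g i).

Definition HeckeA_rel (u v : K) : Prop :=
  braid_rel /\ forall i, g i ^+ 2 = (u ^+ 2)%:A + v *: g i.

End Relations.

Definition YH_gen : Type := ('I_n.-1 + 'I_n)%type.

Lemma Ytilde_sat (q : K) : exists (A : algType K) (f : YH_gen -> A),
  YtildeA_rel (fun i => f (inl i)) (fun j => f (inr j)) q.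
Proof.
pose c : K := d%:R^-1 * d%:R.
have [M M2] := quadratic_witness (1 + (q - 1) * c) ((q - 1) * c).
exists 'M[K]_2, (fun x => match x with inl _ => M | inr _ => 1 end).
have e1 i : e_idem (fun _ : 'I_n => 1 : 'M[K]_2) i = c%:A.
  rewrite /e_idem (eq_bigr (fun=> 1)) => [|s _]; last by rewrite !expr1n mulr1.
  by rewrite sumr_const card_ord -scaler_nat scalerA.
split=> [|i]; last first.
  by rewrite e1 M2 mulr_algl !scalerA [in LHS]scalerDl scale1r.
by split=> // [i j|j]; rewrite ?mulr1 ?mul1r ?expr1n.
Qed.

Lemma YH_sat (u v : K) : exists (A : algType K) (f : YH_gen -> A),
  YA_rel (fun i => f (inl i)) (fun j => f (inr j)) u v.
Proof.
pose c : K := d%:R^-1 * d%:R.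
have [M M2] := quadratic_witness (u ^+ 2) (v * c).
exists 'M[K]_2, (fun x => match x with inl _ => M | inr _ => 1 end).
have e1 i : e_idem (fun _ : 'I_n => 1 : 'M[K]_2) i = c%:A.
  rewrite /e_idem (eq_bigr (fun=> 1)) => [|s _]; last by rewrite !expr1n mulr1.
  by rewrite sumr_const card_ord -scaler_nat scalerA.
split=> [|i]; last by rewrite e1 M2 mulr_algl !scalerA.
by split=> // [i j|j]; rewrite ?mulr1 ?mul1r ?expr1n.
Qed.

Lemma Hecke_sat (u v : K) : exists (A : algType K) (f : 'I_n.-1 -> A),
  HeckeA_rel f u v.
Proof.
have [M M2] := quadratic_witness (u ^+ 2) v.
by exists 'M[K]_2, (fun=> M).
Qed.

Definition Ytilde (q : K) : algType K :=
  palg (@Presentation K YH_gen (fun A f =>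
    YtildeA_rel (fun i => f (inl i)) (fun j => f (inr j)) q) (Ytilde_sat q)).
Definition YH (u v : K) : algType K :=
  palg (@Presentation K YH_gen (fun A f =>
    YA_rel (fun i => f (inl i)) (fun j => f (inr j)) u v) (YH_sat u v)).
Definition Hecke (u v : K) : algType K :=
  palg (@Presentation K 'I_n.-1 (fun A f => HeckeA_rel f u v) (Hecke_sat u v)).

Definition YtildeG q (i : 'I_n.-1) : Ytilde q := pgen _ (inl i).
Definition Ytildet q (j : 'I_n) : Ytilde q := pgen _ (inr j).
Definition YHg u v (i : 'I_n.-1) : YH u v := pgen _ (inl i).
Definition YHt u v (j : 'I_n) : YH u v := pgen _ (inr j).
Definition HeckeT u v (i : 'I_n.-1) : Hecke u v := pgen _ i.

Lemma eq_e_idem (A : algType K) (t t' : 'I_n -> A) i :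
  t =1 t' -> e_idem t i = e_idem t' i.
Proof. by move=> E; congr (_ *: _); apply: eq_bigr => s _; rewrite !E. Qed.

Lemma e_idem_morph (A B : algType K) (h : {lrmorphism A -> B}) t i :
  h (e_idem t i) = e_idem (h \o t) i.
Proof.
rewrite /e_idem linearZ rmorph_sum /=; congr (_ *: _).
by apply: eq_bigr => s _; rewrite rmorphM !rmorphXn.
Qed.

Lemma Hecke_eqP u v (x y : Hecke u v) :
  (forall (A : algType K) (g : 'I_n.-1 -> A) (h : {lrmorphism Hecke u v -> A}),
     (forall i, h (HeckeT u v i) = g i) -> HeckeA_rel g u v -> h x = h y) ->
  x = y.
Proof.
move=> E; apply: palg_eqP => A f Pf.
by apply: (E A f (pliftm Pf)) => // i; apply: pliftm_gen.
Qed.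

Lemma HeckeP u v : HeckeA_rel (@HeckeT u v) u v.
Proof.
repeat split=> *; apply: Hecke_eqP => A g h hg [[Pc Pb] Pq];
  rewrite ?(rmorphXn, rmorphD, rmorphM) /= ?hg.
- exact: Pc.
- exact: Pb.
- by rewrite !linearZ /= rmorph1 hg.
Qed.

Lemma YH_eqP u v (x y : YH u v) :
  (forall (A : algType K) (g : 'I_n.-1 -> A) (t : 'I_n -> A)
     (h : {lrmorphism YH u v -> A}),
     (forall i, h (YHg u v i) = g i) -> (forall j, h (YHt u v j) = t j) ->
     YA_rel g t u v -> h x = h y) -> x = y.
Proof.
move=> E; apply: palg_eqP => A f Pf.
by apply: (E A (f \o inl) (f \o inr) (pliftm Pf)) => // i; apply: pliftm_gen.
Qed.

Lemma YHP u v : YA_rel (@YHg u v) (@YHt u v) u v.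
Proof.
repeat split=> *;
  apply: YH_eqP => A g t h hg ht [[[Pc Pb] Ptt Pgt Ptd] Pq];
  rewrite ?(rmorphXn, rmorphD, rmorphM, rmorph1) /= ?hg ?ht.
- exact: Pc.
- exact: Pb.
- exact: Ptt.
- exact: Pgt.
- exact: Ptd.
- rewrite !linearZ /= rmorph1 rmorphM /= e_idem_morph hg Pq.
  by congr (_ + _ *: (_ * _)); apply: eq_e_idem => j /=.
Qed.

Lemma Ytilde_eqP q (x y : Ytilde q) :
  (forall (A : algType K) (g : 'I_n.-1 -> A) (t : 'I_n -> A)
     (h : {lrmorphism Ytilde q -> A}),
     (forall i, h (YtildeG q i) = g i) -> (forall j, h (Ytildet q j) = t j) ->
     YtildeA_rel g t q -> h x = h y) -> x = y.
Proof.
move=> E; apply: palg_eqP => A f Pf.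
by apply: (E A (f \o inl) (f \o inr) (pliftm Pf)) => // i; apply: pliftm_gen.
Qed.

Lemma YtildeP q : YtildeA_rel (@YtildeG q) (@Ytildet q) q.
Proof.
repeat split=> *;
  apply: Ytilde_eqP => A g t h hg ht [[[Pc Pb] Ptt Pgt Ptd] Pq];
  rewrite ?(rmorphXn, rmorphD, rmorphM, rmorph1) /= ?hg ?ht.
- exact: Pc.
- exact: Pb.
- exact: Ptt.
- exact: Pgt.
- exact: Ptd.
- rewrite linearZ [X in _ + X]linearZ /= rmorphM /= e_idem_morph hg Pq.
  by congr (_ + _ *: _ + _ *: (_ * _)); apply: eq_e_idem => j /=.
Qed.

End YokonumaHecke.

Section Inclusions.
Variables (K : fieldType) (d n : nat).

Definition Ytilde_incl (q : K) : Ytilde d n q -> Ytilde d n.+1 q :=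
  plift (fun x => match x with
    | inl i => YtildeG d q (lo i : 'I_n.+1.-1)
    | inr j => Ytildet d q (widen_ord (leqnSn n) j)
    end).

Definition Hecke_incl (u v : K) : Hecke n u v -> Hecke n.+1 u v :=
  plift (fun i => HeckeT u v (lo i : 'I_n.+1.-1)).

End Inclusions.

Lemma lo_lo n (i : 'I_n.-1) :
  lo (lo i : 'I_n.+1.-1) = widen_ord (leqnSn n) (lo i).
Proof. exact: val_inj. Qed.

Lemma hi_lo n (i : 'I_n.-1) :
  hi (lo i : 'I_n.+1.-1) = widen_ord (leqnSn n) (hi i).
Proof. exact: val_inj. Qed.

Lemma Ytilde_incl_rel (K : fieldType) d n (q : K) :
  YtildeA_rel d (fun i => YtildeG d q (lo i : 'I_n.+1.-1))
    (fun j : 'I_n => Ytildet d q (widen_ord (leqnSn n) j)) q.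
Proof.
have [[[Pc Pb] Ptt Pgt Ptd] Pq] := YtildeP d n.+1 q.
have w_inj : injective (widen_ord (leqnSn n)).
  by move=> x y /(congr1 val) /= /val_inj.
split=> [|i]; last by rewrite Pq /e_idem lo_lo hi_lo.
split=> //; first split=> *; [exact: Pc|exact: Pb|].
by move=> i j; rewrite Pgt /sadj lo_lo hi_lo -inj_tperm.
Qed.

Lemma Hecke_incl_rel (K : fieldType) n (u v : K) :
  HeckeA_rel (fun i => HeckeT u v (lo i : 'I_n.+1.-1)) u v.
Proof.
have [[Pc Pb] Pq] := HeckeP n.+1 u v.
by split=> //; split=> *; [exact: Pc|exact: Pb].
Qed.

(* The index of the last generator G (or T) with n.+2 strands. *)
Definition last_gen (n : nat) : 'I_n.+2.-1 := ord_max.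

Record juyumaya_trace (K : fieldType) (d : nat) (q z : K) (c : nat -> K)
    (tr : forall n, {scalar Ytilde d n q}) : Prop := JuyumayaTrace {
  jt_chain : forall n (x : Ytilde d n q), tr n.+1 (Ytilde_incl x) = tr n x;
  jt_one : forall n, tr n 1 = 1;
  jt_sym : forall n (x y : Ytilde d n q), tr n (x * y) = tr n (y * x);
  jt_G : forall n (x : Ytilde d n.+1 q),
    tr n.+2 (Ytilde_incl x * YtildeG d q (last_gen n)) = z * tr n.+1 x;
  jt_t : forall n (x : Ytilde d n q) b, (b < d)%N ->
    tr n.+1 (Ytilde_incl x * Ytildet d q ord_max ^+ b) = c b * tr n x
}.

(* [trL] is the extension of scalars of [tr] from k to L: both agree on the
   products of generators, which span. *)
Definition scalar_extension (k : fieldType) (L : fieldExtType k) (d : nat)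
    (q : k) (qL : L) (tr : forall n, {scalar Ytilde d n q})
    (trL : forall n, {scalar Ytilde d n qL}) : Prop :=
  forall n (s : seq (YH_gen n)),
    trL n (\prod_(x <- s) match x with
      | inl i => YtildeG d qL i | inr j => Ytildet d qL j end)
    = (tr n (\prod_(x <- s) match x with
        | inl i => YtildeG d q i | inr j => Ytildet d q j end))%:A.

Record hecke_markov_trace (K : fieldType) (u v : K)
    (tau : forall n, {scalar Hecke n u v}) : Prop := HeckeMarkovTrace {
  mt_zero : forall c : K, tau 0%N c%:A = c;
  mt_one : tau 1%N 1 = 1;
  mt_sym : forall n (x y : Hecke n u v), tau n (x * y) = tau n (y * x);
  mt_pos : forall n (x : Hecke n.+1 u v),
    tau n.+2 (Hecke_incl x * HeckeT u v (last_gen n)) = tau n.+1 x;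
  mt_neg : forall n (x : Hecke n.+1 u v) (T' : Hecke n.+2 u v),
    HeckeT u v (last_gen n) * T' = 1 -> T' * HeckeT u v (last_gen n) = 1 ->
    tau n.+2 (Hecke_incl x * T') = tau n.+1 x
}.

(* The identification of YH with Ytilde, for q = sq ^+ 2 and l = sl ^+ 2:
   g_i = sqrt l (sqrt q + (1 - sqrt q) e_i) G_i. *)
Definition YH_to_Ytilde (K : fieldType) (d n : nat) (sq sl : K) :
    YH d n (sq * sl) ((sq ^+ 2 - 1) * sl) -> Ytilde d n (sq ^+ 2) :=
  plift (fun x => match x with
    | inl i => sl *: ((sq%:A + (1 - sq) *: e_idem d (Ytildet d (sq ^+ 2)) i)
                      * YtildeG d (sq ^+ 2) i)
    | inr j => Ytildet d (sq ^+ 2) j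
    end).

Section Compositions.
Variables (d n : nat).

(* Each part of a composition of n is at most n. *)
Definition composition : Type := {ffun 'I_d -> 'I_n.+1}.
Definition Comp : {set {ffun 'I_d -> 'I_n.+1}} :=
  [set mu : {ffun 'I_d -> 'I_n.+1} | (\sum_a mu a)%N == n].

Definition comp_support (mu : composition) : {ffun 'I_d -> bool} :=
  [ffun a => (0 < mu a)%N].

Definition offset (mu : composition) (a : 'I_d) : nat :=
  (\sum_(b < d | (b < a)%N) mu b)%N.

Definition in_block (mu : composition) (a : 'I_d) (j : 'I_n) : bool :=
  (offset mu a <= j < offset mu a + mu a)%N.

Definition Young (mu : composition) : {set 'S_n} :=
  [set w : 'S_n |
    [forall a, forall j, in_block mu a j ==> in_block mu a (w j)]].

Definition multinom (mu : composition) : nat := (n`! %/ \prod_a (mu a)`!)%N.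

Definition min_reps (mu : composition) : {set 'S_n} :=
  [set p : 'S_n | [forall w in Young mu, (len p <= len (pcomp p w))%N]].

Definition min_reps_enum (mu : composition) (pi : 'I_(multinom mu) -> 'S_n) : Prop :=
  [/\ injective pi,
      forall p, p \in min_reps mu <-> exists k, pi k = p
    & forall k : 'I_(multinom mu), k = 0%N :> nat -> pi k = 1%g].

(* The character chi with chi(t_j) = xi_a is encoded by j |-> a. *)
Definition character : Type := {ffun 'I_n -> 'I_d}.

Definition char_act (w : 'S_n) (chi : character) : character :=
  [ffun j => chi ((w^-1)%g j)].

Definition char_comp (chi : character) (mu : composition) : bool :=
  [forall a, #|[set j | chi j == a]| == mu a].

(* For mu in [Comp] each j lies in a block, and [a0] is not used. *)
Definition chi1 (a0 : 'I_d) (mu : composition) : character :=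
  [ffun j => odflt a0 [pick a | in_block mu a j]].

Section OverField.
Variables (K : fieldType) (u v : K) (xi : 'I_d -> K).

Definition E_char (chi : character) : YH d n u v :=
  \prod_(i < n) (d%:R^-1 *:
    \sum_(s < d) xi (chi i) ^+ s *: YHt d u v i ^+ (d - s)).

Definition E_comp (mu : composition) : YH d n u v :=
  \sum_(chi : {ffun 'I_n -> 'I_d} | char_comp chi mu) E_char chi.

Definition g_tilde (s : seq 'I_n.-1) : YH d n u v :=
  u ^- size s *: \prod_(i <- s) YHg d u v i.

Definition T_tilde (s : seq 'I_n.-1) : Hecke n u v :=
  u ^- size s *: \prod_(i <- s) HeckeT u v i.

Definition Hecke_mu (mu : composition) : algType K :=
  subalg (fun x : Hecke n u v =>
    exists2 i, sadj i \in Young mu & x = HeckeT u v i).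

Definition Hecke_mu_val (mu : composition) (x : Hecke_mu mu) : Hecke n u v :=
  subalg_val x.

(* [Psi] is only considered on the algebra E_mu Y, whose unit is E_mu. *)
Record Psi_iso (a0 : 'I_d) (mu : composition) (pi : 'I_(multinom mu) -> 'S_n)
    (Psi : YH d n u v -> 'M[Hecke_mu mu]_(multinom mu)) : Prop := PsiIso {
  Psi_linear : forall (c : K) x y,
    Psi (E_comp mu * (c *: x + y)) =
      c%:A *: Psi (E_comp mu * x) + Psi (E_comp mu * y);
  Psi_mul : forall x y,
    Psi ((E_comp mu * x) * (E_comp mu * y)) =
      Psi (E_comp mu * x) *m Psi (E_comp mu * y);
  Psi_one : Psi (E_comp mu) = 1%:M;
  Psi_inj : forall x y,
    Psi (E_comp mu * x) = Psi (E_comp mu * y) -> E_comp mu * x = E_comp mu * y;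
  Psi_surj : forall M, exists x, Psi (E_comp mu * x) = M;
  Psi_basis : forall k j (w : 'S_n) s s',
    char_act w (char_act (pi j) (chi1 a0 mu)) = char_act (pi k) (chi1 a0 mu) ->
    reduced_word w s ->
    reduced_word (pcomp (pi k)^-1%g (pcomp w (pi j))) s' ->
    map_mx (@Hecke_mu_val mu)
      (Psi (E_char (char_act (pi k) (chi1 a0 mu)) * g_tilde s)) =
    T_tilde s' *: delta_mx k j
}.

(* The embedding of the a-th tensor factor H_(mu_a) of H^mu in H_n; for mu in
   [Comp] the indices below are in range, see [block_emb_rel]. *)
Definition block_emb (mu : composition) (a : 'I_d) :
    Hecke (mu a) u v -> Hecke n u v :=
  plift (fun i : 'I_(mu a).-1 =>
    if insub (offset mu a + i)%N is Some i' then HeckeT u v i' else 0).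

(* [f] is the functional tau_(mu_1) (x) ... (x) tau_(mu_d) on H^mu. *)
Definition tensor_functional (tau : forall m, {scalar Hecke m u v})
    (mu : composition) (f : {scalar Hecke_mu mu}) : Prop :=
  forall (x : forall a : 'I_d, Hecke (mu a) u v) (y : Hecke_mu mu),
    Hecke_mu_val y = \prod_(a < d) block_emb (x a) ->
    f y = \prod_(a < d) tau (mu a) (x a).

End OverField.
End Compositions.

Lemma offset_le d n (mu : composition d n) a :
  mu \in Comp d n -> (offset mu a + mu a <= n)%N.
Proof.
rewrite inE => /eqP En; rewrite -[leqRHS]En (bigD1 a) //= addnC leq_add2l.
rewrite /offset big_mkcond [leqRHS]big_mkcond; apply: leq_sum => b _.
by case: ltngtP => // lt_ba; rewrite neq_ltn lt_ba.
Qed.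

Lemma block_emb_rel (K : fieldType) d n (u v : K) (mu : composition d n) a :
  mu \in Comp d n ->
  HeckeA_rel (fun i : 'I_(mu a).-1 =>
    if insub (offset mu a + i)%N is Some i' then HeckeT u v (i' : 'I_n.-1)
    else 0) u v.
Proof.
move=> /(@offset_le _ _ _ a) le_n; have [[Pc Pb] Pq] := HeckeP n u v.
have lt_n (i : 'I_(mu a).-1) : (offset mu a + i < n.-1)%N.
  by move: (ltn_ord i) le_n; lia.
split=> [|i]; last by rewrite insubT // => lt_i; apply: Pq.
split=> i j ij; rewrite !(insubT (fun k => k < n.-1)%N (lt_n _)).
- by apply: Pc => /=; lia.
- by apply: Pb => /=; lia.
Qed.

(* k = C(sqrt q, z), with C = R[i] for a model R of the real numbers. *)
Definition kfield (R : realType) : fieldType := {fraction {poly {poly R[i]}}}.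

Section TraceData.
Variables (R : realType) (d : nat).

Definition cst (c : R[i]) : kfield R := FracField.tofrac c%:P%:P.
Definition sqrtq : kfield R := FracField.tofrac ('X%:P).
Definition zvar : kfield R := FracField.tofrac 'X.

Variables (xi : 'I_d -> R[i]) (S : {set 'I_d}).

Definition c_S (b : nat) : kfield R :=
  #|S|%:R^-1 * \sum_(a in S) cst (xi a) ^+ b.

Definition E_S : kfield R := #|S|%:R^-1.

Definition lambda_S : kfield R :=
  (zvar + (1 - sqrtq ^+ 2) * E_S) / (sqrtq ^+ 2 * zvar).

Variables (kS : fieldExtType (kfield R)) (sl : kS).

Definition D_S : kS := (sl * zvar%:A)^-1.

Definition rho_S (sq : kS) (trS : forall n, {scalar Ytilde d n (sq ^+ 2)})
    n (x : YH d n (sq * sl) ((sq ^+ 2 - 1) * sl)) : kS :=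
  D_S ^+ n.-1 * trS n (YH_to_Ytilde x).

Definition alpha_S (mu0 : {ffun 'I_d -> bool}) : kS :=
  let size_mu0 := (\sum_a mu0 a)%N in
  if [exists a, (0 < mu0 a)%N && (a \notin S)] then 0
  else D_S ^+ size_mu0.-1 / #|S|%:R ^+ size_mu0.

End TraceData.

(* Main.v *)
(* Both sides are trace functions, so it suffices to compare them on a corner of
   each block E_mu Y.  As Psi_mu identifies E_mu Y with matrices over H^mu, a
   trace function on it is determined by its values on the corner M_11 H^mu,
   which is spanned by the elements E_chi g_{i_1} ... g_{i_r} with
   chi = chi_1^mu and all s_{i_j} in the Young subgroup; Psi_mu maps such an
   element to T_{i_1} ... T_{i_r} M_11.  Its image in the other presentation is
   a product over a of terms P_a(t_k) ... P_a(t_{k+m-1}) theta(x), with P_a(t)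
   the projector on the eigenvalue xi_a of t and x in H_{mu_a}.  Since
   P_a(t_k) P_a(t_{k+1}) g_k = sqrt(lambda) P_a(t_k) P_a(t_{k+1}) G_k, the rules
   defining tr_S become the Markov relations for theta, and induction on m gives
     tr_S (X P_a(t_k) ... P_a(t_{k+m-1}) theta(x)) = c tr_S(X) tau_m(x)
   for X supported on the first k strands, with c = 1 if m = 0, and otherwise
   c = D_S^(1-m) / |S| if a is in S and c = 0 if not.  Multiplying the constants
   over all a gives the parameters alpha. *)

Require Import Defs.
From mathcomp Require Import all_boot all_order all_fingroup all_algebra all_field.
From mathcomp Require Import reals complex.
From mathcomp Require Import generic_quotient boolp zify ring.

Set Implicit Arguments.
Unset Strict Implicit.
Unset Printing Implicit Defensive.

Import GRing.Theory.
Local Open Scope ring_scope.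

(** * Words in the generators, and the trace on partial subalgebras *)

Section Words.
Variables (K : fieldType) (A : algType K) (I : Type) (f : I -> A).

(* Applying the induction hypotheses to [P (_ * y)] and [P (x * _)] avoids
   manipulating linear combinations of words explicitly. *)
Lemma in_subalg_words (Q : pred I) (P : A -> Prop) :
  (forall s, all Q s -> P (\prod_(i <- s) f i)) ->
  (forall x y, P x -> P y -> P (x + y)) -> (forall c x, P x -> P (c *: x)) ->
  forall x, in_subalg (fun y => exists2 i, Q i & y = f i) x -> P x.
Proof.
move=> Pw PD PZ x sx; elim: sx P Pw PD PZ =>
  {x} [x [i Qi ->]||x y _ IHx _ IHy|x y _ IHx _ IHy|c x _ IHx] P Pw PD PZ.
- have /Pw : all Q [:: i] by rewrite /= Qi.
  by rewrite big_seq1.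
- have /Pw : all Q [::] by [].
  by rewrite big_nil.
- by apply: (PD); [apply: (IHx P)|apply: (IHy P)].
- apply: (IHx (fun x => P (x * y))) => [s Qs|a b|c a].
  + apply: (IHy (fun y => P (_ * y))) => [s' Qs'|a b|c a].
    * by rewrite -big_cat; apply: Pw; rewrite all_cat Qs.
    * by rewrite mulrDr; apply: PD.
    * by rewrite -scalerAr; apply: PZ.
  + by rewrite mulrDl; apply: PD.
  + by rewrite -scalerAl; apply: PZ.
- by apply: (PZ); apply: (IHx P).
Qed.

End Words.

(** A formal expression evaluated at the generators is its own class, so the generators generate the
    whole algebra and words span it. *)
Lemma palg_words (K : fieldType) (X : Type) (R : presentation K X)
    (P : palg R -> Prop) :
  (forall s, P (\prod_(i <- s) pgen R i)) ->
  (forall x y, P x -> P y -> P (x + y)) -> (forall c x, P x -> P (c *: x)) ->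
  forall x, P x.
Proof.
move=> Pw PD PZ x; apply: (@in_subalg_words K _ X (pgen R) predT) => //.
rewrite -[x]pclassK -peval_gen.
elim: (repr x) => /= [i|c|p1 IH1 p2 IH2|p1 IH1 p2 IH2].
- by apply: sa_gen; exists i.
- by apply: sa_scale; apply: sa_one.
- exact: sa_add.
- exact: sa_mul.
Qed.

(** * Juyumaya's trace on the subalgebra of the first strands *)

Section LocalTrace.
Variables (K : fieldType) (d : nat) (q : K).

Definition ygen n (x : YH_gen n) : Ytilde d n q :=
  match x with inl i => YtildeG d q i | inr j => Ytildet d q j end.

(** The generators involving only the first [k] strands: G with index [i] touches the strands [i]
    and [i.+1]. The subalgebra [ysub] they generate stays inside one fixed algebra on [n] strands,
    so that no chain of inclusions has to be carried along. *)
Definition below n (k : nat) : pred (YH_gen n) := fun x =>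
  match x with inl i => (i.+1 < k)%N | inr j => (j < k)%N end.

Definition ysub n (k : nat) : Ytilde d n q -> Prop :=
  in_subalg (fun y => exists2 x, below k x & y = ygen x).

Definition widen_gen n (x : YH_gen n) : YH_gen n.+1 :=
  match x with
  | inl i => inl (lo i : 'I_n.+1.-1)
  | inr j => inr (widen_ord (leqnSn n) j)
  end.

Definition Ytilde_inclm n : {lrmorphism Ytilde d n q -> Ytilde d n.+1 q} :=
  @pliftm K (YH_gen n) (Presentation (Ytilde_sat d n q)) (Ytilde d n.+1 q)
    (fun x => ygen (widen_gen x)) (Ytilde_incl_rel d n q).

Lemma Ytilde_inclE n : @Ytilde_incl K d n q =1 @Ytilde_inclm n.
Proof.
by move=> x; congr (plift _ x); apply: funext => -[].
Qed.

Lemma Ytilde_inclM n : {morph @Ytilde_incl K d n q : x y / x * y}.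
Proof. by move=> x y; rewrite !Ytilde_inclE rmorphM. Qed.

Lemma Ytilde_inclX n b : {morph @Ytilde_incl K d n q : x / x ^+ b}.
Proof. by move=> x; rewrite !Ytilde_inclE rmorphXn. Qed.

Lemma Ytilde_incl_ygen n (x : YH_gen n) :
  Ytilde_incl (@ygen n x) = ygen (widen_gen x).
Proof. by case: x => x; rewrite Ytilde_inclE [LHS]pliftm_gen. Qed.

Lemma Ytilde_incl_word n (s : seq (YH_gen n)) :
  Ytilde_incl (\prod_(x <- s) ygen x) = \prod_(x <- map (@widen_gen n) s) ygen x.
Proof.
rewrite Ytilde_inclE rmorph_prod big_map; apply: eq_bigr => x _.
by rewrite -Ytilde_incl_ygen Ytilde_inclE.
Qed.

Lemma below_widen n k (s : seq (YH_gen n.+1)) :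
  (k <= n)%N -> all (below k) s ->
  exists2 s', all (below k) s' & s = map (@widen_gen n) s'.
Proof.
move=> kn; elim: s => [_|x s IH /= /andP[bx /IH [s' bs' ->]]]; first by exists [::].
suff [x' bx' ->] : exists2 x', below k x' & x = widen_gen x'.
  by exists (x' :: s'); rewrite //= bx' bs'.
case: x bx => [i|j] /= b.
  have ltn : (i < n.-1)%N by rewrite ltn_predRL (leq_trans b).
  by exists (inl (Ordinal ltn)) => //=; congr inl; apply: val_inj.
have ltn : (j < n)%N by apply: leq_trans kn.
by exists (inr (Ordinal ltn)) => //=; congr inr; apply: val_inj.
Qed.

Section Juyumaya.
Variables (z : K) (c : nat -> K) (tr : forall n, {scalar Ytilde d n q}).
Hypothesis trP : juyumaya_trace z c tr.

(** The trace rules concern the last strand only; [jt_chain] transfers them to an inner generator,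
    by descending along the inclusions until that generator is the last one. *)
Lemma tr_word_G n (i : 'I_n.-1) (s : seq (YH_gen n)) :
  all (below i.+1) s ->
  tr n (\prod_(x <- s) ygen x * YtildeG d q i) = z * tr n (\prod_(x <- s) ygen x).
Proof.
case: n i s => [|n]; first by case.
elim: n => [|n IH] i s bs; first by case: i bs.
have [s' bs' ->] := below_widen (ltn_ord i) bs.
have [lt_i|ge_i] := ltnP i n; last first.
  have -> : i = last_gen n by apply: val_inj; move: (ltn_ord i) ge_i => /=; lia.
  by rewrite -Ytilde_incl_word (jt_G trP) (jt_chain trP).
pose i' : 'I_n.+1.-1 := Ordinal lt_i.
have -> : i = lo i' :> 'I_n.+2.-1 by apply: val_inj.
have -> : YtildeG d q (lo i' : 'I_n.+2.-1) = Ytilde_incl (YtildeG d q i').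
  by rewrite (Ytilde_incl_ygen (inl i')).
rewrite -Ytilde_incl_word -Ytilde_inclM.
by rewrite !(jt_chain trP) IH.
Qed.

Lemma tr_word_t n (j : 'I_n) (s : seq (YH_gen n)) b :
  (b < d)%N -> all (below j) s ->
  tr n (\prod_(x <- s) ygen x * Ytildet d q j ^+ b)
    = c b * tr n (\prod_(x <- s) ygen x).
Proof.
move=> bd; elim: n j s => [|n IH] j s bs; first by case: j bs.
have [s' bs' ->] := below_widen (ltn_ord j : (j <= n)%N) bs.
have [lt_j|ge_j] := ltnP j n; last first.
  have -> : j = ord_max by apply: val_inj; move: (ltn_ord j) ge_j => /=; lia.
  by rewrite -Ytilde_incl_word (jt_t trP) // (jt_chain trP).
pose j' : 'I_n := Ordinal lt_j.
have -> : j = widen_ord (leqnSn n) j' by apply: val_inj.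
have -> : Ytildet d q (widen_ord (leqnSn n) j') = Ytilde_incl (Ytildet d q j').
  by rewrite (Ytilde_incl_ygen (inr j')).
rewrite -Ytilde_incl_word -Ytilde_inclX -Ytilde_inclM.
by rewrite !(jt_chain trP) IH.
Qed.

End Juyumaya.
End LocalTrace.

(** * Extension of scalars of the trace *)

Section ExtendedTrace.
Variables (k : fieldType) (L : fieldExtType k) (d : nat) (q z : k) (qL : L).
Variables (c : nat -> k) (tr : forall n, {scalar Ytilde d n q}).
Variables (trL : forall n, {scalar Ytilde d n qL}).
Hypotheses (trP : juyumaya_trace z c tr) (trLE : scalar_extension tr trL).

Lemma trL_word n (s : seq (YH_gen n)) :
  trL n (\prod_(x <- s) ygen d qL x) = (tr n (\prod_(x <- s) ygen d q x))%:A.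
Proof. exact: trLE. Qed.

Lemma trL_one n : trL n 1 = 1.
Proof. by have := trL_word (@nil (YH_gen n)); rewrite !big_nil (jt_one trP) scale1r. Qed.

(** Both sides are bilinear, so words suffice, and on words [trL] takes the values of [tr], seen in
    [L]. *)
Lemma trL_sym n (x y : Ytilde d n qL) : trL n (x * y) = trL n (y * x).
Proof.
elim/(@palg_words L): x => [s|x x' IH IH'|a x IH]; last 2 first.
- by rewrite mulrDl mulrDr !linearD IH IH'.
- by rewrite -scalerAl -scalerAr !linearZ /= IH.
elim/(@palg_words L): y => [s'|x x' IH IH'|a x IH]; last 2 first.
- by rewrite mulrDl mulrDr !linearD IH IH'.
- by rewrite -scalerAl -scalerAr !linearZ /= IH.
have E t : \prod_(i <- t) pgen _ i = \prod_(x <- t) @ygen L d qL n x.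
  by apply: eq_bigr => -[].
by rewrite !E -!big_cat !trL_word !big_cat /= (jt_sym trP).
Qed.

Lemma trL_G n (i : 'I_n.-1) (x : Ytilde d n qL) :
  ysub i.+1 x -> trL n (x * YtildeG d qL i) = z%:A * trL n x.
Proof.
move: x; apply: in_subalg_words => [s bs|x x' IH IH'|a x IH]; last 2 first.
- by rewrite mulrDl !linearD /= IH IH' mulrDr.
- by rewrite -scalerAl !linearZ /= IH mulrCA.
have -> : \prod_(x <- s) ygen d qL x * YtildeG d qL i
          = \prod_(x <- s ++ [:: inl i]) ygen d qL x.
  by rewrite big_cat big_seq1.
by rewrite !trL_word big_cat big_seq1 /= (tr_word_G trP) // mulr_algl scalerA.
Qed.

Lemma trL_t n (j : 'I_n) (x : Ytilde d n qL) b :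
  (b < d)%N -> ysub j x ->
  trL n (x * Ytildet d qL j ^+ b) = (c b)%:A * trL n x.
Proof.
move=> bd; move: x; apply: in_subalg_words => [s bs|x x' IH IH'|a x IH]; last 2 first.
- by rewrite mulrDl !linearD /= IH IH' mulrDr.
- by rewrite -scalerAl !linearZ /= IH mulrCA.
have -> : \prod_(x <- s) ygen d qL x * Ytildet d qL j ^+ b
          = \prod_(x <- s ++ nseq b (inr j)) ygen d qL x.
  by rewrite big_cat big_nseq iter_mulr_1.
rewrite !trL_word big_cat big_nseq iter_mulr_1 /= (tr_word_t trP) //.
by rewrite mulr_algl scalerA.
Qed.

End ExtendedTrace.

(** * Projectors on the eigenspaces of a framing generator *)

Section CyclicSums.
Variables (K : fieldType) (d : nat).
Hypothesis d_neq0 : d%:R != 0 :> K.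

Section Algebra.
Variable A : algType K.
Implicit Types x y g : A.

(** When [x] and [y] commute and [y ^+ d = 1], this is the average of the powers of x y^(-1). It
    gives e_i for two framing generators, and an eigenprojector of [y] when [x] is a scalar root of
    unity. *)
Definition cyc_mean x y : A := d%:R^-1 *: \sum_(s < d) x ^+ s * y ^+ (d - s).

(** Up to a factor [y], the sum is the cofactor of [x - y] in [x ^+ d - y ^+ d], which is 0. *)
Lemma cyc_mean_mull x y : GRing.comm x y -> x ^+ d = 1 -> y ^+ d = 1 ->
  x * cyc_mean x y = y * cyc_mean x y.
Proof.
move=> cxy xd yd; rewrite /cyc_mean -!scalerAr; congr (_ *: _).
have -> : \sum_(s < d) x ^+ s * y ^+ (d - s)
    = y * \sum_(s < d) y ^+ (d.-1 - s) * x ^+ s.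
  rewrite mulr_sumr; apply: eq_bigr => s _; rewrite mulrA -exprS.
  have -> : (d.-1 - s).+1 = (d - s)%N by move: (ltn_ord s); lia.
  by apply: commrX; apply/commr_sym/commrX/commr_sym.
apply/eqP; rewrite mulrA cxy -mulrA -subr_eq0 -mulrBr -mulrBl -opprB mulNr.
by rewrite -subrXX_comm ?xd ?yd ?subrr ?oppr0 ?mulr0.
Qed.

(** Replacing [s] by [d - s] exchanges the two sums except for the terms at 0, which are both 1. *)
Lemma cyc_meanC x y : GRing.comm x y -> x ^+ d = 1 -> y ^+ d = 1 ->
  cyc_mean x y = cyc_mean y x.
Proof.
move=> cxy xd yd; congr (_ *: _).
rewrite -!(big_mkord xpredT (fun s => _ ^+ s * _ ^+ (d - s))).
case: d xd yd => [|d'] xd yd; first by rewrite !big_geq.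
rewrite !big_nat_recl // big_nat_rev /= !expr0 !subn0 xd yd; congr (_ + _).
apply: eq_big_nat => s /andP[_ sd]; rewrite add0n.
have -> : (d'.+1 - (d' - s.+1).+1 = s.+1)%N by lia.
have -> : ((d' - s.+1).+1 = d'.+1 - s.+1)%N by lia.
by apply: commrX; apply/commr_sym/commrX/commr_sym.
Qed.

(** On [z] the factor [x] may be replaced by [y], so each of the [d] summands acts as [y ^+ d], that
    is, as 1. *)
Lemma cyc_mean_act x y z : x * z = y * z -> GRing.comm x y -> y ^+ d = 1 ->
  cyc_mean x y * z = z.
Proof.
move=> xz cxy yd; rewrite /cyc_mean -scalerAl mulr_suml.
rewrite (eq_bigr (fun=> z)) => [|s _].
  by rewrite sumr_const card_ord -scaler_nat scalerA mulVf // scale1r.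
have -> : x ^+ s * y ^+ (d - s) = y ^+ (d - s) * x ^+ s.
  by apply: commrX; apply/commr_sym/commrX/commr_sym.
have -> : y ^+ (d - s) * x ^+ s * z = y ^+ (d - s) * y ^+ s * z.
  rewrite -!mulrA; congr (_ * _); elim: (s : nat) => // m IH.
  by rewrite exprS -mulrA IH mulrA (commrX m cxy) -mulrA xz mulrA -exprSr.
by rewrite -exprD subnK ?yd ?mul1r // ltnW.
Qed.

Lemma cyc_mean_idem x y : GRing.comm x y -> x ^+ d = 1 -> y ^+ d = 1 ->
  cyc_mean x y * cyc_mean x y = cyc_mean x y.
Proof. by move=> cxy xd yd; rewrite cyc_mean_act // cyc_mean_mull. Qed.

Lemma cyc_mean_intertwine g x y x' y' : g * x = x' * g -> g * y = y' * g ->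
  g * cyc_mean x y = cyc_mean x' y' * g.
Proof.
move=> gx gy; rewrite -scalerAr -scalerAl mulr_sumr mulr_suml; congr (_ *: _).
have gX z z' m : g * z = z' * g -> g * z ^+ m = z' ^+ m * g.
  by move=> gz; elim: m => [|m IH]; rewrite ?mulr1 ?mul1r // !exprS mulrA gz
    -!mulrA IH.
by apply: eq_bigr => s _; rewrite mulrA (gX _ _ _ gx) -!mulrA (gX _ _ _ gy).
Qed.

End Algebra.

Section Idempotents.
Variable xi : 'I_d -> K.
Hypotheses (xi_inj : injective xi) (xi_root : forall a, xi a ^+ d = 1).

Lemma root_sum a b : \sum_(s < d) xi a ^+ s * xi b ^+ (d - s) = (a == b)%:R * d%:R.
Proof.
have [->|ab] := eqVneq a b.
  rewrite (eq_bigr (fun=> 1)) => [|s _]; first by rewrite sumr_const card_ord mul1r.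
  by rewrite -exprD subnKC ?xi_root // ltnW.
(* For distinct roots, [cyc_mean_mull] in the field seen as an algebra over itself shows that
   [xi a - xi b] times the mean vanishes. *)
rewrite mul0r; pose A : algType K := K^o.
have := @cyc_mean_mull A (xi a) (xi b) (mulrC _ _) (xi_root a) (xi_root b).
move/eqP; rewrite -subr_eq0 -mulrBl mulf_eq0 subr_eq0 (inj_eq xi_inj) (negPf ab).
by rewrite scaler_eq0 invr_eq0 (negPf d_neq0) => /eqP.
Qed.

(** By [root_sum], the square matrices [V] and [W] satisfy [V *m W = 1%:M]; then [W *m V] is the
    identity as well, and its row 0 gives the claim. *)
Lemma root_power_sum s : (s < d)%N -> \sum_a xi a ^+ s = (s == 0%N)%:R * d%:R.
Proof.
move=> sd; pose V := \matrix_(a < d, s < d) xi a ^+ s.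
pose W := \matrix_(s < d, b < d) (d%:R^-1 * xi b ^+ (d - s)).
have /mulmx1C/matrixP WV : V *m W = 1%:M.
  apply/matrixP => a b; rewrite !mxE.
  under eq_bigr => i _ do rewrite !mxE mulrCA.
  by rewrite -mulr_sumr root_sum mulrC -mulrA divff // mulr1.
have d_gt0 : (0 < d)%N by apply: leq_ltn_trans sd.
have := WV (Ordinal d_gt0) (Ordinal sd); rewrite !mxE.
under eq_bigr => i _ do rewrite !mxE /= subn0 xi_root mulr1.
rewrite -mulr_sumr -val_eqE /= eq_sym => /(congr1 ( *%R d%:R)).
by rewrite mulVKf // mulrC.
Qed.

Variable A : algType K.
Implicit Types x y g : A.

(** For [x ^+ d = 1], the projector on the eigenspace of [x] with eigenvalue [xi a], written in the
    same form as the factors of [E_char]. *)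
Definition cyc_idem a x : A := d%:R^-1 *: \sum_(s < d) xi a ^+ s *: x ^+ (d - s).

Lemma cyc_idemE a x : cyc_idem a x = cyc_mean (xi a)%:A x.
Proof.
congr (_ *: _); apply: eq_bigr => s _.
by rewrite exprZn expr1n mulr_algl.
Qed.

Lemma alg_root a : (xi a)%:A ^+ d = 1 :> A.
Proof. by rewrite exprZn xi_root expr1n scale1r. Qed.

Lemma comm_alg (c : K) x : GRing.comm c%:A x.
Proof. by rewrite /GRing.comm mulr_algl mulr_algr. Qed.

Lemma cyc_idem_eigen a x : x ^+ d = 1 -> x * cyc_idem a x = xi a *: cyc_idem a x.
Proof.
move=> xd; rewrite cyc_idemE -cyc_mean_mull ?mulr_algl //; first exact: comm_alg.
exact: alg_root.
Qed.

Lemma cyc_idem_eigenX a x m : x ^+ d = 1 ->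
  x ^+ m * cyc_idem a x = xi a ^+ m *: cyc_idem a x.
Proof.
move=> xd; elim: m => [|m IH]; first by rewrite !expr0 mul1r scale1r.
by rewrite exprSr -mulrA cyc_idem_eigen // -scalerAr IH scalerA -exprS.
Qed.

Lemma cyc_idem_orth a b x : x ^+ d = 1 ->
  cyc_idem a x * cyc_idem b x = (a == b)%:R *: cyc_idem b x.
Proof.
move=> xd; rewrite -scalerAl mulr_suml.
under eq_bigr => s _ do rewrite -scalerAl cyc_idem_eigenX // scalerA.
by rewrite -scaler_suml root_sum scalerA mulrCA mulVf // mulr1.
Qed.

(** After exchanging the sums, [root_power_sum] keeps only the term [s = 0], which is [x ^+ d]. *)
Lemma cyc_idem_sum x : (0 < d)%N -> x ^+ d = 1 -> \sum_a cyc_idem a x = 1.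
Proof.
move=> d_gt0 xd; rewrite -scaler_sumr exchange_big /=.
under eq_bigr => s _ do rewrite -scaler_suml root_power_sum // mulr_natl.
rewrite (bigD1 (Ordinal d_gt0)) //= big1 => [|s s0]; last first.
  by rewrite -(inj_eq val_inj) /= in s0; rewrite (negPf s0) mulr0n scale0r.
by rewrite addr0 subn0 xd mulr1n scalerA mulVf // scale1r.
Qed.

Lemma cyc_idem_intertwine g a x x' : g * x = x' * g ->
  g * cyc_idem a x = cyc_idem a x' * g.
Proof.
move=> gx; rewrite !cyc_idemE; apply: cyc_mean_intertwine => //.
exact/commr_sym/comm_alg.
Qed.

Lemma cyc_idem_comm a g x : GRing.comm g x -> GRing.comm g (cyc_idem a x).
Proof. exact: cyc_idem_intertwine. Qed.

(** On a joint eigenspace with equal eigenvalues [x] and [y] act alike, hence their mean acts as 1.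
    This removes e_i inside a block. *)
Lemma cyc_mean_idem2 a x y : GRing.comm x y -> x ^+ d = 1 -> y ^+ d = 1 ->
  cyc_mean x y * (cyc_idem a x * cyc_idem a y) = cyc_idem a x * cyc_idem a y.
Proof.
move=> cxy xd yd; apply: cyc_mean_act => //.
rewrite mulrA cyc_idem_eigen // -scalerAl mulrA.
by rewrite (cyc_idem_comm a (commr_sym cxy)) -mulrA cyc_idem_eigen // scalerAr.
Qed.

End Idempotents.
End CyclicSums.

Lemma cyc_idem_morph (K : fieldType) d (xi : 'I_d -> K) (A B : algType K)
    (h : {lrmorphism A -> B}) a x : h (cyc_idem xi a x) = cyc_idem xi a (h x).
Proof.
rewrite linearZ rmorph_sum; congr (_ *: _); apply: eq_bigr => s _.
by rewrite /= linearZ /= rmorphXn.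
Qed.

(** * The change of generators between the two presentations *)

Section Identification.
Variables (K : fieldType) (d n : nat) (sq sl : K).
Hypothesis d_neq0 : d%:R != 0 :> K.

Section Relations.
Variables (A : algType K) (g : 'I_n.-1 -> A) (t : 'I_n -> A).
Hypothesis gtP : YtildeA_rel d g t (sq ^+ 2).

Let tC j k : GRing.comm (t j) (t k). Proof. by have [[_ C _ _] _] := gtP. Qed.
Let gt i j : g i * t j = t (sadj i j) * g i. Proof. by have [[_ _ C _] _] := gtP. Qed.
Let td j : t j ^+ d = 1. Proof. by have [[_ _ _ C] _] := gtP. Qed.
Let e j k := cyc_mean d (t j) (t k).
(** Equal to 1 on the image of the idempotent [e j k] and to [sq] on its complement. *)
Let twist j k : A := sq%:A + (1 - sq) *: e j k.

Let e_comm j k x : GRing.comm x (t j) -> GRing.comm x (t k) -> GRing.comm x (e j k).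
Proof. exact: cyc_mean_intertwine. Qed.

Let twist_comm j k x : GRing.comm x (e j k) -> GRing.comm x (twist j k).
Proof.
move=> cx; apply: commrD; first exact/commr_sym/comm_alg.
by rewrite /GRing.comm -scalerAr cx scalerAl.
Qed.

Let twist_commt j k l : GRing.comm (t l) (twist j k).
Proof. exact/twist_comm/e_comm. Qed.

Let twistC j k l m : GRing.comm (twist j k) (twist l m).
Proof.
by apply/twist_comm/e_comm; apply: commr_sym; apply: twist_commt.
Qed.

Let twist_sym j k : twist j k = twist k j.
Proof. by rewrite /twist /e cyc_meanC. Qed.

Let g_twist i j k : g i * twist j k = twist (sadj i j) (sadj i k) * g i.
Proof.
rewrite mulrDr mulrDl mulr_algl mulr_algr -scalerAr -scalerAl.
by congr (_ + _ *: _); apply: cyc_mean_intertwine.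
Qed.

Let h i := sl *: (twist (lo i) (hi i) * g i).

Let e_twist j k : e j k * twist j k = e j k.
Proof.
rewrite mulrDr mulr_algr -scalerAr /e cyc_mean_idem // -scalerDl.
by rewrite addrC subrK scale1r.
Qed.

Let twist_sqr j k : twist j k * twist j k = (sq ^+ 2)%:A + (1 - sq ^+ 2) *: e j k.
Proof.
rewrite {1}/twist mulrDl mulr_algl -scalerAl e_twist /twist scalerDr !scalerA.
by rewrite -addrA -scalerDl -expr2; congr (_ + _ *: _); ring.
Qed.

(** Each generator permutes the twists by permuting strands, so all twists move to the left, where
    they commute; what remains are the relations between the original generators. *)
Lemma Ytilde_twisted_rel :
  YA_rel d (fun i => sl *: ((sq%:A + (1 - sq) *: e_idem d t i) * g i)) t
    (sq * sl) ((sq ^+ 2 - 1) * sl).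
Proof.
have [[[Pc Pb] _ _ _] Pq] := gtP.
have hM i x : h i * x = sl *: (twist (lo i) (hi i) * (g i * x)).
  by rewrite -scalerAl mulrA.
split=> [|i]; last first.
  have -> : h i ^+ 2
      = sl ^+ 2 *: (twist (lo i) (hi i) * twist (lo i) (hi i) * (g i ^+ 2)).
    rewrite exprZn; congr (_ *: _); rewrite expr2 -[LHS]mulrA (mulrA (g i)) g_twist.
    by rewrite /sadj tpermL tpermR (twist_sym (hi i)) -mulrA -expr2 mulrA.
  rewrite -/(h i) -/(e (lo i) (hi i)) Pq -/(e (lo i) (hi i)).
  have -> : e (lo i) (hi i) * h i = sl *: (e (lo i) (hi i) * g i).
    by rewrite -(scalerAr sl) mulrA e_twist.
  rewrite scalerA.
  have twe : twist (lo i) (hi i) * twist (lo i) (hi i) * e (lo i) (hi i) = e (lo i) (hi i).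
    have te : GRing.comm (e (lo i) (hi i)) (twist (lo i) (hi i)).
      exact: twist_comm.
    by rewrite -mulrA -te e_twist -te e_twist.
  (* Here [X] is the squared twist: the term in [E] coming from the quadratic relation cancels the
     one inside [X], since [X * E = E]. *)
  have -> (X E G : A) (q : K) : X = q%:A + (1 - q) *: E -> X * E = E ->
      X * (1 + (q - 1) *: E + (q - 1) *: (E * G)) = q%:A + (q - 1) *: (E * G).
  - move=> XE EE; rewrite !mulrDr mulr1 -!scalerAr mulrA EE {1}XE.
    by rewrite -(addrA q%:A) -scalerDl addrA subrK subrr scale0r addr0.
  - by rewrite scalerDr !scalerA; congr (_ *: _ + _ *: _); ring.
  - exact: twist_sqr.
  - exact: twe.
split=> [|||j] //; last first.
  move=> i j; rewrite -/(h i) hM gt -(scalerAr sl (t _)); congr (_ *: _).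
  by rewrite mulrA -(twist_commt _ _ _) mulrA.
have nb x y : val x != val y -> x != y :> 'I_n by rewrite (inj_eq val_inj).
split=> [i j ij|i j ij]; rewrite -/(h i) -/(h j).
  have [l1 h1] : sadj i (lo j) = lo j /\ sadj i (hi j) = hi j.
    by split; rewrite /sadj tpermD //; apply: nb => /=; lia.
  have [l2 h2] : sadj j (lo i) = lo i /\ sadj j (hi i) = hi i.
    by split; rewrite /sadj tpermD //; apply: nb => /=; lia.
  rewrite !hM -!scalerAr; congr (_ *: (_ *: _)).
  rewrite (mulrA (g i)) (mulrA (g j)) !g_twist l1 h1 l2 h2 -!mulrA.
  by rewrite [LHS]mulrA twistC -mulrA Pc.
have eh : hi i = lo j by apply: val_inj => /=.
have [i1 i2 i3] : [/\ sadj i (lo i) = hi i, sadj i (hi i) = lo i & sadj i (hi j) = hi j].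
  by split; rewrite /sadj ?tpermL ?tpermR ?tpermD //; apply: nb => /=; lia.
have [j1 j2 j3] : [/\ sadj j (hi i) = hi j, sadj j (hi j) = hi i & sadj j (lo i) = lo i].
  by split; rewrite /sadj ?eh ?tpermL ?tpermR ?tpermD //; apply: nb => /=; lia.
(* With the twists collected on the left, the two sides carry the twists of the three pairs among
   the strands [lo i], [hi i], [hi j], in opposite orders. *)
rewrite -!mulrA !hM -eh -!scalerAr; congr (_ *: (_ *: (_ *: _))).
rewrite !(mulrA (g _) (twist _ _)) !g_twist -eh i2 i3 j1 j3 -!mulrA.
rewrite !(mulrA (g _) (twist _ _)) !g_twist i1 i3 j2 j3 -!mulrA.
rewrite (mulrA (g i)) Pb // !mulrA; congr (_ * _ * _ * _).
have rev3 (a b c : A) : a * b = b * a -> a * c = c * a -> b * c = c * b ->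
    a * b * c = c * b * a by move=> ab ac bc; rewrite ab -mulrA ac mulrA bc.
by apply: rev3; apply: twistC.
Qed.

End Relations.

Definition YH_to_Ytildem :
    {lrmorphism YH d n (sq * sl) ((sq ^+ 2 - 1) * sl) -> Ytilde d n (sq ^+ 2)} :=
  @pliftm K (YH_gen n) (Presentation (YH_sat d n _ _)) (Ytilde d n (sq ^+ 2))
    (fun x => match x with
      | inl i => sl *: ((sq%:A + (1 - sq) *: e_idem d (Ytildet d (sq ^+ 2)) i)
                        * YtildeG d (sq ^+ 2) i)
      | inr j => Ytildet d (sq ^+ 2) j
      end) (Ytilde_twisted_rel (YtildeP d n (sq ^+ 2))).

Lemma YH_to_YtildeE : @YH_to_Ytilde K d n sq sl =1 YH_to_Ytildem.
Proof. by []. Qed.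
End Identification.

(** * The Hecke algebra of one more strand *)

Section HeckeInclusion.
Variables (K : fieldType) (u v : K).

Definition Hecke_inclm n : {lrmorphism Hecke n u v -> Hecke n.+1 u v} :=
  @pliftm K _ (Presentation (Hecke_sat n u v)) (Hecke n.+1 u v)
    (fun i => HeckeT u v (lo i : 'I_n.+1.-1)) (Hecke_incl_rel n u v).

Lemma Hecke_inclE n : @Hecke_incl K n u v =1 Hecke_inclm n.
Proof. by []. Qed.

Lemma Hecke_inclM n : {morph @Hecke_incl K n u v : x y / x * y}.
Proof. by move=> x y; rewrite !Hecke_inclE rmorphM. Qed.

Lemma Hecke_inclD n : {morph @Hecke_incl K n u v : x y / x + y}.
Proof. by move=> x y; rewrite !Hecke_inclE linearD. Qed.

Lemma Hecke_inclZ n c : {morph @Hecke_incl K n u v : x / c *: x}.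
Proof. by move=> x; rewrite !Hecke_inclE linearZ. Qed.

Lemma Hecke_incl1 n : @Hecke_incl K n u v 1 = 1.
Proof. by rewrite !Hecke_inclE rmorph1. Qed.

Lemma Hecke_inclT n i :
  @Hecke_incl K n u v (HeckeT u v i) = HeckeT u v (lo i : 'I_n.+1.-1).
Proof. by rewrite Hecke_inclE [LHS]pliftm_gen. Qed.

Lemma Hecke_words n (P : Hecke n u v -> Prop) :
  (forall s, P (\prod_(i <- s) HeckeT u v i)) ->
  (forall x y, P x -> P y -> P (x + y)) -> (forall c x, P x -> P (c *: x)) ->
  forall x, P x.
Proof. exact: palg_words. Qed.

Lemma Hecke_scalar n (x : Hecke n u v) : (n <= 1)%N -> exists c, x = c%:A.
Proof.
move=> n1; elim/Hecke_words: x => [s|x y [a ->] [b ->]|c x [a ->]].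
- case: s => [|i s]; first by exists 1; rewrite big_nil scale1r.
  by move: (ltn_ord i) n1; lia.
- by exists (a + b); rewrite scalerDl.
- by exists (c * a); rewrite scalerA.
Qed.

(** The span of H and H T H, with H the algebra on one strand less and T the last generator: a
    Markov trace on it is determined by its values on H. *)
Inductive last_span m : Hecke m.+2 u v -> Prop :=
  | last_incl x : last_span (Hecke_incl x)
  | last_mid x y : last_span (Hecke_incl x * HeckeT u v (last_gen m) * Hecke_incl y)
  | last_add x y of last_span x & last_span y : last_span (x + y)
  | last_scale c x of last_span x : last_span (c *: x).

Lemma last_comm m (x : Hecke m.+1 u v) :
  GRing.comm (HeckeT u v (last_gen m.+1)) (Hecke_incl (Hecke_incl x)).
Proof.
elim/Hecke_words: x => [s|x y cx cy|c x cx]; last 2 first.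
- by rewrite !Hecke_inclD; apply: commrD.
- by rewrite !Hecke_inclZ /GRing.comm -scalerAr cx scalerAl.
elim: s => [|i s IH]; first by rewrite big_nil !Hecke_incl1; apply: commr1.
rewrite big_cons !Hecke_inclM; apply: commrM => //.
rewrite !Hecke_inclT; have [[Pc _] _] := HeckeP m.+3 u v; apply: Pc.
by move: (ltn_ord i) => /=; lia.
Qed.

(** It is enough to multiply on the left by one generator at a time. The same statement one strand
    lower handles the products T x T. *)
Lemma last_spanT m (x : Hecke m.+2 u v) : last_span x.
Proof.
elim: m x => [|m IHm] x.
  elim/Hecke_words: x => [s|x y|c x]; [|exact: last_add|exact: last_scale].
  elim: s => [|i s IH].
    by rewrite big_nil -Hecke_incl1; apply: last_incl.
  rewrite big_cons; have -> : i = last_gen 0.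
    by apply: val_inj; move: (ltn_ord i) => /=; lia.
  move: (\prod_(j <- s) _) IH => {s i} x; elim => [{}x|{}x y|{}x y _ IHx _ IHy|c {}x _ IHx].
  - by rewrite -[HeckeT _ _ _]mul1r -Hecke_incl1; apply: last_mid.
  - have [c ->] := Hecke_scalar x (leqnn 1); have [_ Pq] := HeckeP 2 u v.
    rewrite Hecke_inclZ Hecke_incl1 mulr_algl -!scalerAl -scalerAr; apply: last_scale.
    rewrite mulrA -expr2 Pq mulrDl mulr_algl -scalerAl; apply: last_add.
      exact/last_scale/last_incl.
    by apply: last_scale; rewrite -[HeckeT _ _ _]mul1r -Hecke_incl1; apply: last_mid.
  - by rewrite mulrDr; apply: last_add.
  - by rewrite -scalerAr; apply: last_scale.
elim/Hecke_words: x => [s|x y|c x]; [|exact: last_add|exact: last_scale].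
elim: s => [|i s IH].
  by rewrite big_nil -Hecke_incl1; apply: last_incl.
rewrite big_cons; move: (\prod_(j <- s) _) IH => {s} x Hx.
have [lt_i|ge_i] := ltnP i m.+1.
  pose i' : 'I_m.+2.-1 := Ordinal lt_i.
  have -> : HeckeT u v i = Hecke_incl (HeckeT u v i').
    by rewrite Hecke_inclT; congr HeckeT; apply: val_inj.
  elim: Hx => [{}x|{}x y|{}x y _ IHx _ IHy|c {}x _ IHx].
  - by rewrite -Hecke_inclM; apply: last_incl.
  - by rewrite !mulrA -Hecke_inclM; apply: last_mid.
  - by rewrite mulrDr; apply: last_add.
  - by rewrite -scalerAr; apply: last_scale.
have {i ge_i} -> : i = last_gen m.+1.
  by apply: val_inj; move: (ltn_ord i) ge_i => /=; lia.
have [[_ Pb] Pq] := HeckeP m.+3 u v.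
have Tl y : last_span (HeckeT u v (last_gen m.+1) * Hecke_incl y).
  by rewrite -[HeckeT _ _ _]mul1r -Hecke_incl1; apply: last_mid.
elim: Hx => [{}x|{}x y|{}x y _ IHx _ IHy|c {}x _ IHx].
- exact: Tl.
(* The element is T x T y. Expanding [x] leaves T z T, which is z T^2 and falls to the quadratic
   relation, or T z T' w T, which is z T T' T w and falls to the braid relation. *)
- elim: (IHm x) => [z|z w|z w _ IHz _ IHw|c z _ IHz].
  + rewrite !mulrA last_comm -[_ * _ * HeckeT _ _ _]mulrA -expr2 Pq.
    rewrite mulrDr mulrDl mulr_algr -scalerAl -scalerAr -scalerAl; apply: last_add.
      by rewrite -Hecke_inclM; apply/last_scale/last_incl.
    exact/last_scale/last_mid.
  + rewrite !Hecke_inclM Hecke_inclT; set T' := HeckeT u v (lo (last_gen m) : 'I_m.+3.-1).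
    set T := HeckeT u v (last_gen m.+1).
    have -> : T * (Hecke_incl (Hecke_incl z) * T' * Hecke_incl (Hecke_incl w)
                * T * Hecke_incl y)
      = Hecke_incl (Hecke_incl z) * (T * T' * T) * Hecke_incl (Hecke_incl w)
                * Hecke_incl y.
      rewrite !mulrA last_comm -!mulrA; do 3 congr (_ * _).
      by rewrite !mulrA last_comm.
    rewrite -(Pb (lo (last_gen m) : 'I_m.+3.-1) (last_gen m.+1)) // -/T'.
    rewrite !mulrA /T' -Hecke_inclT -Hecke_inclM -!mulrA -!Hecke_inclM !mulrA.
    exact: last_mid.
  + by rewrite Hecke_inclD mulrDl !mulrDl mulrDr; apply: last_add.
  + by rewrite Hecke_inclZ -!scalerAl -scalerAr; apply: last_scale.
- by rewrite mulrDr; apply: last_add.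
- by rewrite -scalerAr; apply: last_scale.
Qed.

Section Markov.
Variable tau : forall n, {scalar Hecke n u v}.
Hypothesis tauP : hecke_markov_trace tau.
Hypotheses (u_neq0 : u != 0) (v_neq0 : v != 0).

(** The quadratic relation gives the inverse of [T] as [T']. The Markov conditions give [x] times
    [T] and [x] times [T'] the same value, and comparing them yields the value on [x] itself. *)
Lemma markov_incl n (x : Hecke n.+1 u v) :
  tau n.+2 (Hecke_incl x) = (1 - u ^+ 2) / v * tau n.+1 x.
Proof.
set T := HeckeT u v (last_gen n).
pose T' := u ^- 2 *: (T - v%:A).
have u2 : u ^+ 2 != 0 by rewrite expf_neq0.
have T2 : T * T = (u ^+ 2)%:A + v *: T.
  by have [_ Pq] := HeckeP n.+2 u v; rewrite -expr2 Pq.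
have TT' : T * T' = 1.
  rewrite -scalerAr mulrBr mulr_algr T2 addrK scalerA mulVf //.
  by rewrite scale1r.
have T'T : T' * T = 1.
  rewrite -scalerAl mulrBl mulr_algl T2 addrK scalerA mulVf //.
  by rewrite scale1r.
have := mt_neg tauP x TT' T'T; have := mt_pos tauP x; rewrite -/T.
rewrite -scalerAr mulrBr mulr_algr linearZ linearB linearZ /= => -> E.
apply: (mulfI v_neq0); rewrite mulrA mulrCA divff // mulr1 mulrBl mul1r.
by rewrite -[X in _ - _ * X]E mulVKf // opprB addrC subrK.
Qed.

End Markov.
End HeckeInclusion.

(** * One block of strands *)

Section Commutation.
Variables (K : fieldType) (A : algType K).
Implicit Types x y g : A.

(** Meant for a generator that exchanges two neighbouring projectors of a block and commutes with
    the others; as these two projectors commute, their product is preserved. *)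
Lemma comm_prod_swap g (p : nat -> A) a b i : (a <= i)%N -> (i.+1 < b)%N ->
  (forall j, (a <= j < b)%N -> j != i -> j != i.+1 -> GRing.comm g (p j)) ->
  g * p i = p i.+1 * g -> g * p i.+1 = p i * g -> GRing.comm (p i) (p i.+1) ->
  GRing.comm g (\prod_(a <= j < b) p j).
Proof.
move=> ai ib gp gi gi1 pp.
have cprod a' b' : (a <= a')%N -> (b' <= b)%N -> (b' <= i)%N || (i.+1 < a')%N ->
    GRing.comm g (\prod_(a' <= j < b') p j).
  move=> aa bb i_out; rewrite big_nat; apply: commr_prod => j /andP[j1 j2].
  by apply: gp; lia.
rewrite (big_cat_nat ai) /=; last by lia.
rewrite (@big_cat_nat _ _ _ i.+2 i b) /=; [|lia|lia].
rewrite (big_ltn (m := i)) // big_nat1.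
apply: commrM; first by apply: cprod; rewrite ?leqnn ?orbT //; lia.
apply: commrM; last by apply: cprod; rewrite ?ltnSn ?orbT //; lia.
by rewrite /GRing.comm mulrA gi -mulrA gi1 mulrA pp.
Qed.

(** The element [c] is carried past the factors before [a] and absorbed by the factor at [a]. *)
Lemma prod_update d (c : A) (a : 'I_d) (F F' : 'I_d -> A) :
  (forall b : 'I_d, (b < a)%N -> GRing.comm c (F b)) -> c * F a = F' a ->
  (forall b, b != a -> F b = F' b) ->
  c * \prod_b F b = \prod_b F' b.
Proof.
elim: d a F F' => [|d IH] a F F'; first by case: a.
move=> cF cFa FF'; rewrite !big_ord_recl.
have [a0|a_gt0] := posnP a.
  have -> : ord0 = a by apply: val_inj.
  rewrite mulrA cFa; congr (_ * _); apply: eq_bigr => b _.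
  by apply: FF'; rewrite -(inj_eq val_inj) /= a0.
have lt_a : (a.-1 < d)%N by move: (ltn_ord a); lia.
have aE : lift ord0 (Ordinal lt_a) = a by apply: val_inj; rewrite /= /bump; lia.
rewrite mulrA cF // -mulrA FF'; last by rewrite -(inj_eq val_inj) /=; lia.
congr (_ * _); apply: (IH (Ordinal lt_a)).
- by move=> b ba; apply: cF; rewrite /= /bump; move: ba => /=; lia.
- by rewrite aE.
- by move=> b ba; apply: FF'; rewrite -aE (inj_eq (lift_inj (h := ord0))).
Qed.

(** For an idempotent [E] commuting with [x], this acts as [x] on the image of [E] and as the scalar
    [c] on its complement. *)
Definition corner (E x : A) (c : K) := E * x + c *: (1 - E).

Lemma cornerM (E x y : A) c c' : E * E = E -> GRing.comm E x ->
  corner E x c * corner E y c' = corner E (x * y) (c * c').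
Proof.
move=> EE Ex; have E0 : E * (1 - E) = 0 by rewrite mulrBr mulr1 EE subrr.
have E0' : (1 - E) * E = 0 by rewrite mulrBl mul1r EE subrr.
have F2 : (1 - E) * (1 - E) = 1 - E by rewrite mulrBl mul1r E0 subr0.
rewrite /corner mulrDl !mulrDr -!scalerAl -!scalerAr F2 scalerA.
rewrite (mulrA (1 - E)) E0' mul0r scaler0 add0r.
rewrite Ex -[x * E * (1 - E)]mulrA E0 mulr0 scaler0 addr0.
by rewrite mulrA -(mulrA x) EE -Ex -mulrA.
Qed.

(** When [c] is a root of X^2 = r + b X, this extends that equation from the image of [E] to the
    whole algebra. *)
Lemma corner_affine (E x : A) b c r :
  corner E (r%:A + b *: x) (r + b * c) = r%:A + b *: corner E x c.
Proof.
rewrite /corner mulrDr mulr_algr -scalerAr scalerDl -scalerA scalerDr addrACA.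
by rewrite -!scalerDr [E + _]addrC subrK.
Qed.

Lemma mul_corner (E x : A) c : E * E = E -> E * corner E x c = E * x.
Proof. by move=> EE; rewrite mulrDr mulrA -scalerAr mulrBr mulr1 EE subrr scaler0 addr0. Qed.

Lemma comm_corner (E x g : A) c : GRing.comm g E -> GRing.comm g x ->
  GRing.comm g (corner E x c).
Proof.
move=> gE gx; apply: commrD; first exact: commrM.
rewrite /GRing.comm -scalerAr -scalerAl; congr (_ *: _).
by apply: commrB => //; apply: commr1.
Qed.

End Commutation.

(** * Hecke algebras acting on a block of strands with a common eigenvalue *)

Section Block.
Variables (K : fieldType) (d n : nat) (sq sl : K) (xi : 'I_d -> K).
Hypotheses (d_neq0 : d%:R != 0 :> K) (xi_inj : injective xi).
Hypothesis xi_root : forall a, xi a ^+ d = 1.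

Local Notation q := (sq ^+ 2).
Local Notation u := (sq * sl).
Local Notation v := ((sq ^+ 2 - 1) * sl).
Local Notation A := (Ytilde d n q).
Local Notation G := (@YtildeG K d n q).
Local Notation t := (@Ytildet K d n q).

(** The image of the generator g_i under the identification of the two presentations. *)
Definition hgen (i : 'I_n.-1) : A := sl *: ((sq%:A + (1 - sq) *: e_idem d t i) * G i).

(* Out of range, these are equal to 1. *)
Definition hext (i : nat) : A := oapp hgen 1 (insub i).
Definition tidem (a : 'I_d) (j : nat) : A :=
  oapp (fun j => cyc_idem xi a (t j)) 1 (insub j).

Definition Ysub (k : nat) : {pred A} :=
  subalg_pred (fun y => exists2 x : YH_gen n, below k x & y = ygen d q x).

Let relG : YtildeA_rel d G t q := YtildeP d n q.
Let relH : YA_rel d hgen t u v := Ytilde_twisted_rel sl d_neq0 relG.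
Let tC j k : GRing.comm (t j) (t k). Proof. by have [[_ C _ _] _] := relG. Qed.
Let td j : t j ^+ d = 1. Proof. by have [[_ _ _ C] _] := relG. Qed.
Let Gt i j : G i * t j = t (sadj i j) * G i.
Proof. by have [[_ _ C _] _] := relG. Qed.
Let ht i j : hgen i * t j = t (sadj i j) * hgen i.
Proof. by have [[_ _ C _] _] := relH. Qed.

Lemma hextE i (lt_i : (i < n.-1)%N) : hext i = hgen (Ordinal lt_i).
Proof. by rewrite /hext insubT. Qed.

Lemma hext_ord (i : 'I_n.-1) : hgen i = hext i.
Proof. by rewrite (hextE (ltn_ord i)); congr hgen; apply: val_inj. Qed.

Lemma tidemE a j (lt_j : (j < n)%N) : tidem a j = cyc_idem xi a (t (Ordinal lt_j)).
Proof. by rewrite /tidem insubT. Qed.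

Lemma tidem_comm a b i j : GRing.comm (tidem a i) (tidem b j).
Proof.
rewrite /tidem; case: insubP => [i' _ _|_] /=; last exact/commr_sym/commr1.
case: insubP => [j' _ _|_] /=; last exact: commr1.
by do 2!(apply: cyc_idem_comm; apply: commr_sym).
Qed.

Lemma tidem_idem a j : tidem a j * tidem a j = tidem a j.
Proof.
rewrite /tidem; case: insubP => [j' _ _|_] /=; last exact: mulr1.
by rewrite cyc_idem_orth // eqxx scale1r.
Qed.

Lemma sadj_id (i : 'I_n.-1) (j : 'I_n) :
  j != i :> nat -> j != i.+1 :> nat -> sadj i j = j.
Proof. by move=> ji ji1; rewrite /sadj tpermD // -(inj_eq val_inj) /= eq_sym. Qed.

Lemma hext_tidem_comm a i j : j != i -> j != i.+1 -> GRing.comm (hext i) (tidem a j).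
Proof.
rewrite /hext; case: insubP => [i' _ <-|_] /=; last by move=> *; apply/commr_sym/commr1.
rewrite /tidem; case: insubP => [j' _ <-|_] /= ji ji1; last exact: commr1.
by apply: cyc_idem_comm; rewrite /GRing.comm ht sadj_id.
Qed.

Lemma hext_tideml a i : (i.+1 < n)%N -> hext i * tidem a i = tidem a i.+1 * hext i.
Proof.
move=> lt_i; have lt_i' : (i < n.-1)%N by lia.
have lt_i0 : (i < n)%N by lia.
rewrite hextE !tidemE; apply: cyc_idem_intertwine; rewrite ht.
congr (t _ * _); have -> : Ordinal lt_i0 = lo (Ordinal lt_i') by apply: val_inj.
by rewrite /sadj tpermL; apply: val_inj.
Qed.

Lemma hext_tidemr a i : (i.+1 < n)%N -> hext i * tidem a i.+1 = tidem a i * hext i.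
Proof.
move=> lt_i; have lt_i' : (i < n.-1)%N by lia.
have lt_i0 : (i < n)%N by lia.
rewrite hextE !tidemE; apply: cyc_idem_intertwine; rewrite ht.
congr (t _ * _); have -> : Ordinal lt_i = hi (Ordinal lt_i') by apply: val_inj.
by rewrite /sadj tpermR; apply: val_inj.
Qed.

Lemma G_tidem a i (lt_i : (i < n.-1)%N) :
  G (Ordinal lt_i) * tidem a i = tidem a i.+1 * G (Ordinal lt_i).
Proof.
have lt_i0 : (i < n)%N by lia.
have lt_i1 : (i.+1 < n)%N by lia.
rewrite !tidemE; apply: cyc_idem_intertwine; rewrite Gt.
congr (t _ * _); have -> : Ordinal lt_i0 = lo (Ordinal lt_i) by apply: val_inj.
by rewrite /sadj tpermL; apply: val_inj.
Qed.

Let e_pp a i (lt_i : (i < n.-1)%N) :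
  tidem a i * tidem a i.+1 * e_idem d t (Ordinal lt_i) = tidem a i * tidem a i.+1.
Proof.
have lt_i0 : (i < n)%N by lia.
have lt_i1 : (i.+1 < n)%N by lia.
have -> : tidem a i = cyc_idem xi a (t (lo (Ordinal lt_i))).
  by rewrite tidemE; congr (cyc_idem _ _ (t _)); apply: val_inj.
have -> : tidem a i.+1 = cyc_idem xi a (t (hi (Ordinal lt_i))).
  by rewrite tidemE; congr (cyc_idem _ _ (t _)); apply: val_inj.
rewrite -[RHS](cyc_mean_idem2 d_neq0 xi_root a (tC _ _)) //.
apply: commr_sym; apply: commrM; apply/commr_sym/cyc_mean_intertwine;
  by apply/commr_sym/cyc_idem_comm/tC.
Qed.

(** On equal eigenvalues e_i acts as 1, so the twist in [hgen] becomes 1. *)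
Lemma tidem_hext_G a i (lt_i : (i < n.-1)%N) :
  tidem a i * tidem a i.+1 * hext i = sl *: (tidem a i * tidem a i.+1 * G (Ordinal lt_i)).
Proof.
rewrite hextE /hgen -scalerAr mulrA mulrDr mulr_algr -scalerAr e_pp.
by rewrite -scalerDl addrC subrK scale1r.
Qed.

Lemma tidem_hext_sqr a i : (i.+1 < n)%N ->
  tidem a i * tidem a i.+1 * (hext i * hext i)
    = tidem a i * tidem a i.+1 * ((u ^+ 2)%:A + v *: hext i).
Proof.
move=> lt_i; have lt_i' : (i < n.-1)%N by lia.
rewrite -expr2 hextE; have [_ ->] := relH; rewrite !mulrDr; congr (_ + _).
by rewrite -!scalerAr mulrA e_pp.
Qed.

Lemma Ysub_mono k l : (k <= l)%N -> {subset Ysub k <= Ysub l}.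
Proof.
move=> kl x /asboolP sx; apply/asboolP.
elim: sx => {x} [x [y by_ ->]||x y _ sx _ sy|x y _ sx _ sy|c x _ sx].
- apply: sa_gen; exists y => //; case: y by_ => y /= H; exact: leq_trans kl.
- exact: sa_one.
- exact: sa_add.
- exact: sa_mul.
- exact: sa_scale.
Qed.

Lemma Ysub_t k (j : 'I_n) : (j < k)%N -> t j \in Ysub k.
Proof. by move=> jk; apply/asboolP/sa_gen; exists (inr j). Qed.

Lemma Ysub_G k (i : 'I_n.-1) : (i.+1 < k)%N -> G i \in Ysub k.
Proof. by move=> ik; apply/asboolP/sa_gen; exists (inl i). Qed.

Lemma Ysub_tidem k a j : (j < k)%N -> tidem a j \in Ysub k.
Proof.
rewrite /tidem; case: insubP => [j' _ <-|_] /= jk; last exact: rpred1.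
by apply/rpredZ/rpred_sum => s _; apply/rpredZ/rpredX/Ysub_t.
Qed.

Lemma Ysub_hext k i : (i.+1 < k)%N -> hext i \in Ysub k.
Proof.
rewrite /hext; case: insubP => [i' _ <-|_] /= ik; last exact: rpred1.
apply/rpredZ/rpredM; last exact: Ysub_G.
apply: rpredD; first exact/rpredZ/rpred1.
apply/rpredZ/rpredZ/rpred_sum => s _.
by apply: rpredM; apply/rpredX/Ysub_t => //=; lia.
Qed.

Lemma Ysub_comm g k : (forall j : 'I_n, (j < k)%N -> GRing.comm g (t j)) ->
  (forall i : 'I_n.-1, (i.+1 < k)%N -> GRing.comm g (G i)) ->
  forall x, x \in Ysub k -> GRing.comm g x.
Proof.
move=> gt gG x /asboolP.
elim => {x} [x [[i|j] lt ->]||x y _ gx _ gy|x y _ gx _ gy|c x _ gx].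
- exact: gG.
- exact: gt.
- exact: commr1.
- exact: commrD.
- exact: commrM.
- by rewrite /GRing.comm -scalerAr gx scalerAl.
Qed.

Lemma tidem_Ysub_comm a j k x : (k <= j)%N -> x \in Ysub k -> GRing.comm (tidem a j) x.
Proof.
move=> kj; apply: Ysub_comm => [i ik|i ik]; rewrite /tidem;
  case: insubP => [j' _ jE|_] /=; try exact/commr_sym/commr1.
  by apply: commr_sym; apply: cyc_idem_comm.
apply: commr_sym; apply: cyc_idem_comm.
by rewrite /GRing.comm Gt sadj_id // -[nat_of_ord j']/(val j') jE; lia.
Qed.

Lemma hext_Ysub_comm i k x : (k <= i)%N -> x \in Ysub k -> GRing.comm (hext i) x.
Proof.
move=> ki; apply: Ysub_comm => [j jk|j jk]; rewrite /hext;
  case: insubP => [i' _ iE|_] /=; try exact/commr_sym/commr1.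
  by rewrite /GRing.comm ht sadj_id // -[nat_of_ord i']/(val i') iE; lia.
apply: commr_sym; rewrite /GRing.comm -scalerAr -scalerAl; congr (_ *: _).
apply: commrM; last first.
  by have [[[Pc _] _ _ _] _] := relG; apply: Pc; rewrite -[nat_of_ord i']/(val i') iE; lia.
apply: commrD; first exact/commr_sym/comm_alg.
rewrite /GRing.comm -scalerAr -scalerAl; congr (_ *: _).
by apply: cyc_mean_intertwine; rewrite Gt sadj_id //= -[nat_of_ord i']/(val i') iE; lia.
Qed.

Definition block a k m : A := \prod_(k <= j < k + m) tidem a j.

Lemma tidem_block_comm a b j k m : GRing.comm (tidem a j) (block b k m).
Proof. by apply: commr_prod => i _; apply: tidem_comm. Qed.

Lemma blockS a k m : block a k m.+1 = block a k m * tidem a (k + m).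
Proof. by rewrite /block addnS big_nat_recr ?leq_addr. Qed.

Lemma block_idem a k m : block a k m * block a k m = block a k m.
Proof.
elim: m => [|m IH]; first by rewrite /block addn0 big_geq // mulr1.
rewrite blockS mulrA -(mulrA (block a k m)) tidem_block_comm mulrA IH.
by rewrite -mulrA tidem_idem.
Qed.

Lemma block_tidem a k m j : (k <= j < k + m)%N -> block a k m * tidem a j = block a k m.
Proof.
elim: m => [|m IH] /andP[kj jkm]; first by move: kj jkm; lia.
rewrite blockS -mulrA; have [->|jm] := eqVneq j (k + m)%N; first by rewrite tidem_idem.
by rewrite tidem_comm mulrA IH //; lia.
Qed.

Lemma Ysub_block a k m l : (k + m <= l)%N -> block a k m \in Ysub l.
Proof.
move=> kml; rewrite /block big_nat; apply: rpred_prod => j /andP[_ jk].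
by apply: Ysub_tidem; apply: leq_trans kml.
Qed.

Lemma block_hext_comm a k m i : (k <= i)%N -> (i.+1 < k + m)%N -> (k + m <= n)%N ->
  GRing.comm (hext i) (block a k m).
Proof.
move=> ki im mn; apply: (comm_prod_swap ki im) => [j _ ji ji1|||].
- exact: hext_tidem_comm.
- by apply: hext_tideml; apply: leq_trans mn.
- by apply: hext_tidemr; apply: leq_trans mn.
- exact: tidem_comm.
Qed.

Lemma block_hext_sqr a k m i : (k <= i)%N -> (i.+1 < k + m)%N -> (k + m <= n)%N ->
  block a k m * (hext i * hext i) = block a k m * ((u ^+ 2)%:A + v *: hext i).
Proof.
move=> ki im mn; have E : block a k m = block a k m * (tidem a i * tidem a i.+1).
  by rewrite mulrA !block_tidem //; lia.
by rewrite E -!(mulrA (block a k m)) tidem_hext_sqr //; apply: leq_trans mn.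
Qed.

(* Off the block, the generators act by the root [sq ^+ 2 * sl] of
   [x ^+ 2 = u ^+ 2 + v * x]: this makes [theta] unital. *)
Definition theta_gen a k m (i : 'I_m.-1) : A :=
  corner (block a k m) (hext (k + i)) (sq ^+ 2 * sl).

(** On the block e_i is 1, so the quadratic relation is that of the Hecke algebra; off the block all
    generators act by one and the same scalar, for which the braid relations are clear. *)
Lemma theta_rel a k m : (k + m <= n)%N -> HeckeA_rel (@theta_gen a k m) u v.
Proof.
move=> kmn; have [[[Pc Pb] _ _ _] _] := relH.
have EE := block_idem a k m.
have Eh (i : 'I_m.-1) : GRing.comm (block a k m) (hext (k + i)).
  by apply: commr_sym; apply: block_hext_comm => //; move: (ltn_ord i); lia.
have lt_n (i : 'I_m.-1) : (k + i < n.-1)%N by move: (ltn_ord i); lia.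
split=> [|i]; last first.
  rewrite [theta_gen a k i ^+ 2]expr2 cornerM // -corner_affine.
  have -> : (sq ^+ 2 * sl) * (sq ^+ 2 * sl) = u ^+ 2 + v * (sq ^+ 2 * sl) by ring.
  by rewrite /corner block_hext_sqr //; move: (ltn_ord i); lia.
split=> i j ij.
  rewrite !cornerM // !(hextE (lt_n _)) Pc //=; move: ij; lia.
by rewrite !cornerM //; try (by apply: commrM); rewrite !(hextE (lt_n _)) Pb //=; lia.
Qed.

Definition theta a k m (kmn : (k + m <= n)%N) : {lrmorphism Hecke m u v -> A} :=
  @pliftm K _ (Presentation (Hecke_sat m u v)) A (@theta_gen a k m) (theta_rel a kmn).

Lemma thetaT a k m (kmn : (k + m <= n)%N) i :
  theta a kmn (HeckeT u v i) = theta_gen a k i.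
Proof. exact: pliftm_gen. Qed.

Lemma block_theta_word a k m (kmn : (k + m <= n)%N) (s : seq 'I_m.-1) :
  block a k m * theta a kmn (\prod_(i <- s) HeckeT u v i)
    = block a k m * \prod_(i <- s) hext (k + i).
Proof.
elim: s => [|i s IH]; first by rewrite !big_nil rmorph1.
rewrite !big_cons rmorphM /= thetaT mulrA mul_corner ?block_idem //.
rewrite -block_hext_comm; try by move: (ltn_ord i); lia.
by rewrite -mulrA IH mulrA block_hext_comm ?mulrA //; move: (ltn_ord i); lia.
Qed.

Lemma Ysub_theta a k m (kmn : (k + m <= n)%N) x : theta a kmn x \in Ysub (k + m).
Proof.
elim/Hecke_words: x => [s|x y sx sy|c x sx]; last 2 first.
- by rewrite linearD rpredD.
- by rewrite linearZ rpredZ.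
rewrite rmorph_prod; apply: rpred_prod => i _ /=; rewrite thetaT.
have sE : block a k m \in Ysub (k + m) by apply: Ysub_block.
apply: rpredD; last by apply/rpredZ/rpredB => //; apply: rpred1.
by apply: rpredM => //; apply: Ysub_hext; move: (ltn_ord i); lia.
Qed.

Lemma theta_Ysub_comm a k m (kmn : (k + m <= n)%N) x y : y \in Ysub k ->
  GRing.comm y (theta a kmn x).
Proof.
move=> sy; elim/Hecke_words: x => [s|x z cx cz|c x cx]; last 2 first.
- by rewrite linearD; apply: commrD.
- by rewrite linearZ /GRing.comm -scalerAr cx scalerAl.
rewrite rmorph_prod; apply: commr_prod => i _ /=; rewrite thetaT.
apply: comm_corner; last by apply/commr_sym/(hext_Ysub_comm _ sy)/leq_addr.
rewrite /block big_nat; apply: commr_prod => j /andP[kj _].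
exact/commr_sym/(tidem_Ysub_comm _ kj).
Qed.

Lemma block_theta_comm a k m (kmn : (k + m <= n)%N) x :
  GRing.comm (block a k m) (theta a kmn x).
Proof.
elim/Hecke_words: x => [s|x z cx cz|c x cx]; last 2 first.
- by rewrite linearD; apply: commrD.
- by rewrite linearZ /GRing.comm -scalerAr cx scalerAl.
rewrite rmorph_prod; apply: commr_prod => i _ /=; rewrite thetaT.
apply: comm_corner => //; apply: commr_sym; apply: block_hext_comm => //; last first.
  by move: (ltn_ord i); lia.
exact: leq_addr.
Qed.

(** The two maps differ only in their values off a block, and the larger block annihilates these. *)
Lemma block_theta_incl a k m (kmn : (k + m.+1 <= n)%N) (kmn' : (k + m <= n)%N) x :
  block a k m.+1 * theta a kmn (Hecke_incl x) = block a k m.+1 * theta a kmn' x.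
Proof.
elim/Hecke_words: x => [s|x z cx cz|c x cx]; last 2 first.
- by rewrite Hecke_inclD !linearD !mulrDr /= cx cz.
- by rewrite Hecke_inclZ !linearZ /= -!scalerAr cx.
have -> : Hecke_incl (\prod_(i <- s) HeckeT u v i)
   = \prod_(i <- map (fun i => lo i : 'I_m.+1.-1) s) HeckeT u v i.
  rewrite Hecke_inclE rmorph_prod big_map.
  by apply: eq_bigr => i _; rewrite -Hecke_inclT.
rewrite block_theta_word big_map blockS -tidem_block_comm -!mulrA; congr (_ * _).
by rewrite block_theta_word.
Qed.

Section Trace.
Variables (z E0 : K) (S : {set 'I_d}) (tr : {scalar A}).
Variable tau : forall m, {scalar Hecke m u v}.
Hypothesis trC : forall x y, tr (x * y) = tr (y * x).
Hypothesis trG : forall (i : 'I_n.-1) x, x \in Ysub i.+1 -> tr (x * G i) = z * tr x.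
Hypothesis trP : forall a j x, (j < n)%N -> x \in Ysub j ->
  tr (x * tidem a j) = (if a \in S then E0 else 0) * tr x.
Hypothesis tauP : hecke_markov_trace tau.
Hypotheses (u_neq0 : u != 0) (v_neq0 : v != 0) (z_neq0 : z != 0).
Hypothesis E0_eq : (1 - u ^+ 2) / v = (sl * z)^-1 * E0.

(** The constant attached to a block, [sl * z] playing the part of the inverse of [D_S]. An empty
    block weighs 1 whether or not [a] is in [S], and the exponent counts all strands but one. *)
Definition block_weight a m : K :=
  if m is m'.+1 then if a \in S then (sl * z) ^+ m' * E0 else 0 else 1.

(** Induction on the number of strands through [last_spanT]: for each kind of element, one strand is
    removed from [tr] and from [tau], with matching factors. *)
Lemma block_trace a k m (kmn : (k + m <= n)%N) X (x : Hecke m u v) : X \in Ysub k ->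
  tr (X * (block a k m * theta a kmn x)) = block_weight a m * tr X * tau m x.
Proof.
have sl_neq0 : sl != 0 by apply: contra u_neq0 => /eqP ->; rewrite mulr0.
move=> sX; case: m kmn x => [|m] kmn x.
  have [c ->] := Hecke_scalar x isT.
  rewrite /block addn0 big_geq // mul1r linearZ rmorph1 /= mulr_algr linearZ /=.
  by rewrite (mt_zero tauP) mul1r mulrC.
elim: m kmn x => [|m IH] kmn x.
  have [c ->] := Hecke_scalar x isT.
  rewrite /block addn1 big_nat1 linearZ rmorph1 /= mulr_algr -scalerAr !linearZ /=.
  rewrite trP //; last by move: kmn; rewrite addn1.
  by rewrite (mt_one tauP) mulr1 expr0 mul1r mulrC.
have kmn' : (k + m.+1 <= n)%N by apply: leq_trans kmn; lia.
have sB := Ysub_block a (leqnn (k + m.+1)).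
have sX' : X \in Ysub (k + m.+1) by apply: Ysub_mono sX; lia.
have Xh y : GRing.comm X (theta a kmn y) by apply: theta_Ysub_comm.
elim: (last_spanT x) => [y|y w|y w _ IHy _ IHw|c y _ IHy].
(* Without the last generator, the last projector contributes [E0] or 0, and [tau] the factor of
   [markov_incl], equal to [E0] over [sl * z] by [E0_eq]. *)
- rewrite block_theta_incl blockS -(mulrA (block _ _ _)).
  rewrite (tidem_Ysub_comm _ (leqnn _) (Ysub_theta a kmn' y)) !mulrA.
  rewrite trP ?rpredM ?Ysub_theta //; last by clear -kmn; lia.
  rewrite -mulrA IH (markov_incl tauP) // E0_eq /= (exprS (sl * z)).
  by case: ifP => _; [field; rewrite sl_neq0 z_neq0|rewrite !mul0r].
- set T := HeckeT u v (last_gen m); pose B := block a k m.+2.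
  have BB : B * B = B by apply: block_idem.
  have Bth s : GRing.comm B (theta a kmn s) by apply: block_theta_comm.
  have lt_i : (k + m < n.-1)%N by clear -kmn; lia.
  have lt_i' : (k + m).+1 = (k + m.+1)%N by rewrite addnS.
  (* The last but one projector is duplicated, being absorbed by the shorter block; the pair thus
     formed turns [hext (k + m)] into [sl] times a generator G. *)
  have Bblock : B = block a k m.+1 * (tidem a (k + m) * tidem a (k + m).+1).
    rewrite mulrA block_tidem; last by lia.
    by rewrite /B blockS lt_i'.
  have Bw s : GRing.comm B (theta a kmn' s).
    rewrite /B blockS; apply/commr_sym/commrM; apply: commr_sym.
      exact: block_theta_comm.
    exact: tidem_Ysub_comm (leqnn _) (Ysub_theta a kmn' s).
  have Bh : GRing.comm B (hext (k + m)).
    by apply/commr_sym/block_hext_comm => //; lia.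
  have BT : B * theta a kmn T = B * hext (k + m).
    by rewrite thetaT mul_corner.
  have Bincl s : B * theta a kmn (Hecke_incl s) = B * theta a kmn' s.
    exact: block_theta_incl.
  have mid : B * theta a kmn (Hecke_incl y * T * Hecke_incl w)
      = B * theta a kmn' y * hext (k + m) * theta a kmn' w.
    have alg (b x1 x2 x3 y1 y2 y3 : A) : b * x1 = x1 * b -> b * x2 = b * y2 ->
        b * y2 = y2 * b -> b * x1 = b * y1 -> b * x3 = b * y3 ->
        b * (x1 * x2 * x3) = b * y1 * y2 * y3.
      move=> c1 c2 c3 c4 c5; rewrite -c4 c1 -(mulrA x1 b) c3 -!mulrA -c5.
      by rewrite (mulrA y2) -c3 -c2 !mulrA c1.
    rewrite !rmorphM /=; apply: alg;
      [exact: Bth|exact: BT|exact: Bh|exact: Bincl|exact: Bincl].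
  have Gp : tidem a (k + m).+1 * G (Ordinal lt_i) = G (Ordinal lt_i) * tidem a (k + m).
    by rewrite -G_tidem.
  (* The projector of the last strand crosses G and reappears on its right as the projector of
     strand [k + m]. *)
  have last : B * (theta a kmn' w * theta a kmn' y) * hext (k + m)
      = sl *: (block a k m.+1 * theta a kmn' (w * y) * G (Ordinal lt_i) * tidem a (k + m)).
    rewrite -rmorphM Bw -mulrA Bblock -(mulrA (block _ _ _)) (tidem_hext_G _ lt_i).
    rewrite -!scalerAr -(mulrA (tidem _ _)) Gp !mulrA.
    rewrite -(mulrA (theta a kmn' _) (block _ _ _)) block_tidem; last by lia.
    by rewrite block_theta_comm.
  (* Cyclicity brings the image of [w] to the front, from where it passes [X] and [B] to join the
     image of [y]. *)
  rewrite mid mulrA trC.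
  have -> : theta a kmn' w * (X * (B * theta a kmn' y * hext (k + m)))
     = X * (B * (theta a kmn' w * theta a kmn' y) * hext (k + m)).
    rewrite !mulrA -(theta_Ysub_comm a kmn' w sX) -(mulrA X) -Bw.
    by rewrite !mulrA.
  (* By cyclicity again the trailing projector comes to the front, commutes with [X] and is absorbed
     by the block; then [trG] applies. *)
  rewrite last -scalerAr linearZ /= mulrA trC !mulrA.
  rewrite (tidem_Ysub_comm a (leq_addr m k) sX) -(mulrA X) tidem_block_comm.
  rewrite block_tidem; last by lia.
  rewrite -(mulrA X) trG; last first.
    by rewrite /= -addnS; do 2![apply: rpredM => //]; apply: Ysub_theta.
  rewrite IH (mt_sym tauP (_ * _)) (mulrA (Hecke_incl w)) -Hecke_inclM.
  rewrite (mt_pos tauP) /= (exprS (sl * z)).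
  by case: ifP => _; ring.
- by rewrite !linearD !mulrDr linearD /= IHy IHw.
- by rewrite !linearZ /= -!scalerAr linearZ /= IHy mulrCA.
Qed.

End Trace.

End Block.

(** * Products of blocks *)

(** Passing to a range of natural numbers, with a neutral default out of range, permits induction on
    the number of factors. *)
Lemma big_ord_ext (R : Type) (idx : R) (op : Monoid.law idx) m (F : 'I_m -> R) :
  \big[op/idx]_(i < m) F i = \big[op/idx]_(0 <= i < m) oapp F idx (insub i).
Proof. by rewrite big_mkord; apply: eq_bigr => i _; rewrite valK. Qed.

Section CompositionBlocks.
Variables (d n : nat) (mu : composition d n).

(** The offset, also defined at the end [r = d], where it is [n] for a composition of [n]. *)
Definition prefix_sum (r : nat) : nat := (\sum_(b < d | (b < r)%N) mu b)%N.

Lemma prefix_sumS r (lt_r : (r < d)%N) :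
  prefix_sum r.+1 = (prefix_sum r + mu (Ordinal lt_r))%N.
Proof.
rewrite /prefix_sum (bigD1 (Ordinal lt_r)) //= addnC; congr (_ + _)%N.
by apply: eq_bigl => b; rewrite -(inj_eq val_inj) /=; lia.
Qed.

Lemma prefix_sum0 : prefix_sum 0 = 0%N. Proof. by rewrite /prefix_sum big_pred0. Qed.

Lemma prefix_sum_mono r s : (r <= s)%N -> (prefix_sum r <= prefix_sum s)%N.
Proof.
move=> rs; rewrite /prefix_sum big_mkcond [leqRHS]big_mkcond.
by apply: leq_sum => b _; case: ifP => // br; rewrite (leq_trans br rs).
Qed.

Lemma offset_lt (a b : 'I_d) : (a < b)%N -> (offset mu a + mu a <= offset mu b)%N.
Proof.
move=> ab; have := prefix_sum_mono ab; rewrite (prefix_sumS (ltn_ord a)).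
by congr (_ + mu _ <= _)%N; apply: val_inj.
Qed.

Hypothesis muC : mu \in Comp d n.

Lemma prefix_sum_all : prefix_sum d = n.
Proof.
move: muC; rewrite inE => /eqP <-.
by apply: eq_bigl => b; rewrite ltn_ord.
Qed.

Lemma in_block_ex (j : 'I_n) : exists a, in_block mu a j.
Proof.
suff ex r : (r <= d)%N -> (j < prefix_sum r)%N -> exists a, in_block mu a j.
  by apply: (ex d) => //; rewrite prefix_sum_all.
elim: r => [|r IH] rd; first by rewrite prefix_sum0.
have [lt_j _|ge_j] := ltnP j (prefix_sum r); first by apply: IH => //; apply: ltnW.
by rewrite (prefix_sumS rd) => lt_j; exists (Ordinal rd); rewrite /in_block ge_j.
Qed.

Lemma in_block_uniq a b (j : 'I_n) : in_block mu a j -> in_block mu b j -> a = b.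
Proof.
move=> /andP[a1 a2] /andP[b1 b2]; apply: val_inj.
by have [/offset_lt|/offset_lt|//] := ltngtP a b; lia.
Qed.

Lemma chi1E a0 a (j : 'I_n) : in_block mu a j -> chi1 a0 mu j = a.
Proof.
move=> aj; rewrite ffunE; case: pickP => [b bj|/(_ a)]; last by rewrite aj.
exact: in_block_uniq bj aj.
Qed.

Lemma char_comp_chi1 a0 : char_comp (chi1 a0 mu) mu.
Proof.
apply/forallP => a; rewrite (eq_card (B := mem [set j : 'I_n | in_block mu a j])).
  have := sum_nat_const_nat (offset mu a) (offset mu a + mu a) 1.
  rewrite addKn muln1 (big_nat_widenl _ 0) //.
  rewrite (big_nat_widen _ _ n) ?offset_le // big_mkord => card_block.
  by rewrite -[X in _ == X]card_block -sum1_card; apply/eqP/eq_bigl => j; rewrite !inE.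
move=> j; rewrite !inE; have [b bj] := in_block_ex j; rewrite (chi1E a0 bj).
by apply/eqP/idP => [<- //|aj]; apply: in_block_uniq aj.
Qed.

(** The block containing [lo i] is stable under the transposition, hence also contains [hi i]. *)
Lemma Young_block (i : 'I_n.-1) : sadj i \in Young mu ->
  exists a, (offset mu a <= i)%N /\ (i.+1 < offset mu a + mu a)%N.
Proof.
rewrite inE => /forallP Yi; have [a ai] := in_block_ex (lo i); exists a.
have := Yi a => /forallP/(_ (lo i))/implyP/(_ ai); rewrite /sadj tpermL.
by move: ai; rewrite /in_block /=; lia.
Qed.

Section Embedding.
Variables (K : fieldType) (u v : K).

Definition block_embm a : {lrmorphism Hecke (mu a) u v -> Hecke n u v} :=
  @pliftm K _ (Presentation (Hecke_sat (mu a) u v)) (Hecke n u v)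
    (fun i : 'I_(mu a).-1 =>
       if insub (offset mu a + i)%N is Some i' then HeckeT u v i' else 0)
    (block_emb_rel u v a muC).

Lemma block_embE a : @block_emb d n K u v mu a =1 block_embm a.
Proof. by []. Qed.

Lemma block_embT a (i : 'I_(mu a).-1) (j : 'I_n.-1) : j = (offset mu a + i)%N :> nat ->
  block_embm a (HeckeT u v i) = HeckeT u v j.
Proof. by move=> ji; rewrite [LHS]pliftm_gen -ji valK. Qed.

Lemma block_emb_comm a (x : Hecke (mu a) u v) (j : 'I_n.-1) :
  (offset mu a + mu a <= j)%N -> GRing.comm (HeckeT u v j) (block_embm a x).
Proof.
move=> aj; elim/Hecke_words: x => [s|x y cx cy|c x cx]; last 2 first.
- by rewrite linearD; apply: commrD.
- by rewrite linearZ /GRing.comm -scalerAr cx scalerAl.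
rewrite rmorph_prod; apply: commr_prod => i _ /=.
have lt_i : (offset mu a + i < n.-1)%N.
  by move: (ltn_ord i) (offset_le a muC); lia.
rewrite (block_embT (j := Ordinal lt_i)) //.
have [[Pc _] _] := HeckeP n u v; apply: Pc => /=; move: (ltn_ord i); lia.
Qed.

End Embedding.
End CompositionBlocks.

(** * Words in the Young subgroup and their traces *)

Section Blocks.
Variables (K : fieldType) (d n : nat) (sq sl : K) (xi : 'I_d -> K).
Hypotheses (d_neq0 : d%:R != 0 :> K) (xi_inj : injective xi).
Hypothesis xi_root : forall a, xi a ^+ d = 1.
Variable mu : composition d n.
Hypothesis muC : mu \in Comp d n.

Local Notation u := (sq * sl).
Local Notation v := ((sq ^+ 2 - 1) * sl).
Local Notation A := (Ytilde d n (sq ^+ 2)).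
Local Notation t := (@Ytildet K d n (sq ^+ 2)).
Local Notation h := (@hgen K d n sq sl).
Local Notation Ysub := (@Ysub K d n sq).

(** The image of the [E_char] of [chi1] in the first presentation. *)
Definition chi1_idem (a0 : 'I_d) : A :=
  \prod_(j < n) cyc_idem xi (chi1 a0 mu j) (t j).

Definition mu_block a : A := block n sq xi a (offset mu a) (mu a).

Definition mu_theta a (x : Hecke (mu a) u v) : A :=
  mu_block a * theta sq sl d_neq0 xi_inj xi_root a (offset_le a muC) x.

Lemma chi1_idemE a0 : chi1_idem a0 = \prod_(a < d) mu_block a.
Proof.
rewrite /chi1_idem !big_ord_ext.
pose F j : A := oapp (fun j : 'I_n => cyc_idem xi (chi1 a0 mu j) (t j)) 1 (insub j).
pose B a : A := oapp mu_block 1 (insub a).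
suff E r : (r <= d)%N ->
    \prod_(0 <= j < prefix_sum mu r) F j = \prod_(0 <= a < r) B a.
  by have := E d (leqnn d); rewrite prefix_sum_all.
elim: r => [|r IH] rd; first by rewrite prefix_sum0 !big_geq.
have oS := prefix_sumS mu rd.
have o_le : (prefix_sum mu r <= prefix_sum mu r.+1)%N by rewrite oS leq_addr.
rewrite (big_nat_recr _ _ _ (leq0n r)) -(IH (ltnW rd)).
rewrite (big_cat_nat (leq0n _) o_le).
congr (_ * _); rewrite /B insubT /= oS; apply: eq_big_nat => j /andP[j1 j2].
have jn : (j < n)%N by apply: leq_trans j2 (offset_le (Ordinal rd) muC).
rewrite /F insubT tidemE /=; congr (cyc_idem _ _ _).
by apply: (chi1E muC); rewrite /in_block /= j1.
Qed.

(** In its own block the generator exchanges two projectors for the same eigenvalue; the other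
    blocks do not meet its two strands. *)
Lemma mu_block_hgen a (i : 'I_n.-1) : sadj i \in Young mu ->
  GRing.comm (h i) (mu_block a).
Proof.
move=> /(Young_block muC)[b [b1 b2]].
have hE := hext_ord d sq sl i.
rewrite hE; have [->|ab] := eqVneq a b.
  exact: (block_hext_comm sq sl xi d_neq0 b b1 b2 (offset_le b muC)).
rewrite /mu_block /block big_nat; apply: commr_prod => j /andP[j1 j2].
have := @offset_lt d n mu; move: ab; rewrite -(inj_eq val_inj) => ab olt.
by apply: hext_tidem_comm => //; case: (ltngtP a b) ab => [/olt|/olt|]; lia.
Qed.

Lemma chi1_idem_hgen a0 (i : 'I_n.-1) : sadj i \in Young mu ->
  GRing.comm (h i) (chi1_idem a0).
Proof. by move=> Yi; rewrite chi1_idemE; apply: commr_prod => a _; apply: mu_block_hgen. Qed.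

Lemma Ysub_mu_theta a x r : (offset mu a + mu a <= r)%N -> @mu_theta a x \in Ysub r.
Proof.
move=> ar; apply: (Ysub_mono ar); apply: rpredM; last exact: Ysub_theta.
exact: Ysub_block.
Qed.

(** One family [x] serves both factorizations: each letter belongs to one block, commutes with the
    factors of the earlier blocks and is absorbed by the factor of its own. *)
Lemma Young_word a0 (s : seq 'I_n.-1) : all (fun i => sadj i \in Young mu) s ->
  exists x : forall a, Hecke (mu a) u v,
    \prod_(i <- s) HeckeT u v i = \prod_(a < d) block_emb (x a)
    /\ chi1_idem a0 * \prod_(i <- s) h i = \prod_(a < d) mu_theta (x a).
Proof.
elim: s => [_|i s IH /= /andP[Yi /IH[x [Tx hx]]]].
  exists (fun a => 1); rewrite !big_nil mulr1 chi1_idemE; split.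
    by rewrite big1 // => a _; rewrite (block_embE muC) rmorph1.
  by apply: eq_bigr => a _; rewrite /mu_theta rmorph1 mulr1.
have [a [a1 a2]] := Young_block muC Yi.
have lt_i : (i - offset mu a < (mu a).-1)%N by lia.
pose i0 : 'I_(mu a).-1 := Ordinal lt_i.
have iE : i = (offset mu a + i0)%N :> nat by rewrite /= subnKC.
(* Only the component at [a] changes; [i0] is the position of the letter inside its block. *)
exists (dfwith x (HeckeT u v i0 * x a)); rewrite !big_cons; split.
  rewrite Tx; apply: (@prod_update _ _ _ _ a) => [b /(@offset_lt _ _ mu) ba||b ba].
  - by rewrite (block_embE muC); apply: block_emb_comm => //; apply: leq_trans a1.
  - by rewrite dfwith_in !(block_embE muC) rmorphM /= (block_embT muC _ _ iE).
  - by rewrite dfwith_out // eq_sym.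
rewrite mulrA -chi1_idem_hgen // -mulrA hx.
have hE := hext_ord d sq sl i.
apply: (@prod_update _ _ _ _ a) => [b /(@offset_lt _ _ mu) ba||b ba].
- by rewrite hE; apply: (hext_Ysub_comm _ _ a1) => //; apply: Ysub_mu_theta.
- rewrite dfwith_in /mu_theta rmorphM /= thetaT [LHS]mulrA mu_block_hgen //.
  by rewrite [RHS]mulrA mul_corner ?block_idem // -iE -hE.
- by rewrite dfwith_out // eq_sym.
Qed.

Section Trace.
Variables (z E0 : K) (S : {set 'I_d}) (tr : {scalar A}).
Variable tau : forall m, {scalar Hecke m u v}.
Hypotheses (trC : forall x y, tr (x * y) = tr (y * x)) (tr1 : tr 1 = 1).
Hypothesis trG : forall (i : 'I_n.-1) x, x \in Ysub i.+1 ->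
  tr (x * YtildeG d (sq ^+ 2) i) = z * tr x.
Hypothesis trP : forall a j x, (j < n)%N -> x \in Ysub j ->
  tr (x * tidem n sq xi a j) = (if a \in S then E0 else 0) * tr x.
Hypothesis tauP : hecke_markov_trace tau.
Hypotheses (u_neq0 : u != 0) (v_neq0 : v != 0) (z_neq0 : z != 0).
Hypothesis E0_eq : (1 - u ^+ 2) / v = (sl * z)^-1 * E0.

(** Blocks are removed starting from the last: the product of the first [r] of them lives on the
    first [prefix_sum mu r] strands and plays the part of [X] in [block_trace]. *)
Lemma mu_theta_trace (x : forall a, Hecke (mu a) u v) :
  tr (\prod_(a < d) mu_theta (x a))
    = \prod_(a < d) (block_weight sl z E0 S a (mu a) * tau (mu a) (x a)).
Proof.
rewrite !big_ord_ext; pose F a : A := oapp (fun a => mu_theta (x a)) 1 (insub a).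
pose W a : K :=
  oapp (fun a => block_weight sl z E0 S a (mu a) * tau (mu a) (x a)) 1 (insub a).
suff E r : (r <= d)%N -> \prod_(0 <= a < r) F a \in Ysub (prefix_sum mu r) /\
    tr (\prod_(0 <= a < r) F a) = \prod_(0 <= a < r) W a by have [] := E d (leqnn d).
elim: r => [|r IH] rd; first by rewrite !big_geq // rpred1.
have [sF trF] := IH (ltnW rd); rewrite !big_nat_recr //= (prefix_sumS mu rd).
rewrite {2 4}/F {2}/W !insubT /=; split.
  apply: rpredM; last exact: Ysub_mu_theta.
  by apply: Ysub_mono sF; apply: leq_addr.
rewrite (block_trace d_neq0 xi_inj xi_root trC trG trP tauP u_neq0 v_neq0 z_neq0 E0_eq) // trF.
by rewrite mulrA (mulrC _ (\prod_(_ <= _ < _) _)).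
Qed.

Lemma Young_word_trace a0 (f : {scalar Hecke_mu u v mu}) s (y : Hecke_mu u v mu) :
  tensor_functional tau f -> all (fun i => sadj i \in Young mu) s ->
  Hecke_mu_val y = \prod_(i <- s) HeckeT u v i ->
  tr (chi1_idem a0 * \prod_(i <- s) h i)
    = (\prod_(a < d) block_weight sl z E0 S a (mu a)) * f y.
Proof.
move=> fP sY yE; have [x [Tx ->]] := Young_word a0 sY.
by rewrite mu_theta_trace (fP x) ?yE // big_split.
Qed.

End Trace.
End Blocks.

(** * Traces through the matrix algebras *)

(** Scalars from a non-commutative ring pass through, since the entries of [delta_mx] are 0 and
    1. *)
Lemma delta_mxZr (R : nzRingType) m (i j : 'I_m) (y : R) (M : 'M[R]_m) :
  delta_mx i j *m (y *: M) = y *: (delta_mx i j *m M).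
Proof.
apply/matrixP => k l; rewrite !mxE mulr_sumr; apply: eq_bigr => p _; rewrite !mxE.
by case: (_ && _); rewrite ?mul1r ?mul0r ?mulr0.
Qed.

Lemma len1 n : len (1%g : 'S_n) = 0%N.
Proof.
rewrite /len; case: ex_minnP => m _ /(_ 0%N) H; apply/eqP; rewrite -leqn0.
by apply: H; apply/asboolP; exists [::].
Qed.

Lemma wprod1 n (i : 'I_n.-1) : wprod [:: i] = sadj i.
Proof. by rewrite /= /Defs.pcomp mul1g. Qed.

Lemma reduced_sadj n (i : 'I_n.-1) : reduced_word (sadj i) [:: i].
Proof.
split; first exact: wprod1.
rewrite /len; case: ex_minnP => m /asboolP [s ws sm] min_m; apply/eqP; rewrite eq_sym eqn_leq.
apply/andP; split; first by apply: min_m; apply/asboolP; exists [:: i] => //; apply: wprod1.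
rewrite lt0n -sm; apply: contra_eq_neq ws => /size0nil -> /=.
apply/eqP => /permP /(_ (lo i)); rewrite perm1 /sadj tpermL => /(congr1 val) /=; lia.
Qed.

(** * Orthogonal idempotents attached to characters and compositions *)

Section CharacterIdempotents.
Variables (K : fieldType) (d n : nat) (u v : K) (xi : 'I_d -> K).
Hypotheses (d_neq0 : d%:R != 0 :> K) (xi_inj : injective xi).
Hypothesis xi_root : forall a, xi a ^+ d = 1.
Hypothesis d_gt0 : (0 < d)%N.

Local Notation t := (@YHt K d n u v).
Local Notation E_char := (E_char u v xi).
Local Notation E_comp := (E_comp u v xi).

Let td j : t j ^+ d = 1.
Proof. by have [[_ _ _ C] _] := YHP d n u v. Qed.

(** All factors commute, and at a position where the characters differ the product of the two
    projectors is 0. *)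
Lemma E_char_orth (chi chi' : character d n) :
  E_char chi * E_char chi' = (chi == chi')%:R *: E_char chi'.
Proof.
have tC i j : GRing.comm (t i) (t j) by have [[_ C _ _] _] := YHP d n u v.
rewrite /E_char -prodrM_comm => [|i j _ _]; last first.
  by do 2!(apply: cyc_idem_comm; apply: commr_sym).
have [->|/eqP neq] := eqVneq chi chi'.
  by rewrite scale1r; apply: eq_bigr => i _; rewrite cyc_idem_orth // eqxx scale1r.
have [i neq_i] : exists i, chi i != chi' i.
  apply: contrapT => eq_i; apply: neq; apply/ffunP => i; apply/eqP.
  by apply: contrapT => /negP ni; apply: eq_i; exists i.
have i0 : cyc_idem xi (chi i) (t i) * cyc_idem xi (chi' i) (t i) = 0.
  by rewrite cyc_idem_orth // (negPf neq_i) scale0r.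
rewrite scale0r; have : i \in index_enum 'I_n by rewrite mem_index_enum.
elim: (index_enum _) => // j s IH; rewrite inE big_cons => /orP[/eqP <-|/IH ->].
  by rewrite i0 mul0r.
by rewrite mulr0.
Qed.

Lemma E_char_sum : \sum_(chi : {ffun 'I_n -> 'I_d}) E_char chi = 1.
Proof.
rewrite -(bigA_distr_bigA (fun i a => cyc_idem xi a (t i))).
by rewrite big1 // => i _; apply: cyc_idem_sum.
Qed.

Lemma E_comp_char (mu : composition d n) chi :
  char_comp chi mu -> E_comp mu * E_char chi = E_char chi.
Proof.
move=> cm; rewrite mulr_suml (bigD1 chi) //= E_char_orth eqxx scale1r.
rewrite big1 ?addr0 // => chi' /andP[_ neq].
by rewrite E_char_orth (negPf neq) scale0r.
Qed.

(** Each character is counted once, by the composition recording the sizes of its fibres. *)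
Lemma E_comp_sum : \sum_(mu in Comp d n) E_comp mu = 1.
Proof.
rewrite -E_char_sum /E_comp (exchange_big_dep xpredT) //=.
apply: eq_bigr => chi _.
have lt_card (a : 'I_d) : (#|[set j | chi j == a]| < n.+1)%N.
  by rewrite ltnS -[leqRHS]card_ord max_card.
pose mu : composition d n := [ffun a => Ordinal (lt_card a)].
have chi_mu : char_comp chi mu by apply/forallP => a; rewrite ffunE.
rewrite (big_pred1 mu) // => nu /=; apply/andP/eqP => [[_ chi_nu]|->].
  apply/ffunP => a; apply: val_inj; rewrite ffunE /=.
  by rewrite -(eqP (forallP chi_nu a)).
split=> //; rewrite inE; apply/eqP; rewrite -[RHS]card_ord -sum1_card.
rewrite (partition_big chi xpredT) //=; apply: eq_bigr => a _.
by rewrite ffunE /= -sum1_card; apply: eq_bigl => j; rewrite inE.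
Qed.

End CharacterIdempotents.

Section PsiTrace.
Variables (K : fieldType) (d n : nat) (u v : K) (xi : 'I_d -> K).
Hypotheses (d_neq0 : d%:R != 0 :> K) (xi_inj : injective xi).
Hypotheses (xi_root : forall a, xi a ^+ d = 1) (u_neq0 : u != 0).
Variables (a0 : 'I_d) (mu : composition d n) (pi : 'I_(multinom mu) -> 'S_n).
Variable Psi : YH d n u v -> 'M[Hecke_mu u v mu]_(multinom mu).
Hypothesis muC : mu \in Comp d n.
Hypothesis piP : min_reps_enum pi.
Hypothesis PsiP : Psi_iso xi a0 pi Psi.

Local Notation Y := (YH d n u v).
Local Notation H := (Hecke_mu u v mu).
Local Notation Emu := (E_comp u v xi mu).
Local Notation E1 := (E_char u v xi (chi1 a0 mu)).
Local Notation val := (@Hecke_mu_val d n K u v mu).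
Let Ygen (x : Hecke n u v) := exists2 i, sadj i \in Young mu & x = HeckeT u v i.
Let g : 'I_n.-1 -> Y := @YHg K d n u v.
Let T : 'I_n.-1 -> Hecke n u v := @HeckeT K n u v.

Lemma pi1_ex : exists k0, pi k0 = 1%g.
Proof.
have [_ /(_ 1%g)[H _] _] := piP; apply: H.
by rewrite inE; apply/forallP => w; rewrite len1 implybT.
Qed.

Variables (k0 : 'I_(multinom mu)) (pi_k0 : pi k0 = 1%g).

Let EmuE1 : Emu * E1 = E1.
Proof. by apply: E_comp_char => //; apply: char_comp_chi1. Qed.

Let act1 (chi : character d n) : char_act 1%g chi = chi.
Proof. by apply/ffunP => j; rewrite ffunE invg1 perm1. Qed.

Let EmuE1M x : Emu * (E1 * x) = E1 * x.
Proof. by rewrite mulrA EmuE1. Qed.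

Let Psi0 : Psi 0 = 0.
Proof.
have := Psi_linear PsiP (-1) 0 0; rewrite scaler0 addr0 mulr0.
by rewrite scaleN1r scaleN1r addNr.
Qed.

Let PsiZ b x : Psi (Emu * (b *: x)) = b%:A *: Psi (Emu * x).
Proof. by have := Psi_linear PsiP b x 0; rewrite !addr0 !mulr0 Psi0 addr0. Qed.

Let rval : {rmorphism H -> Hecke n u v} := (\val : {rmorphism subalg Ygen -> _}).

Let valA b : val b%:A = b%:A.
Proof.
have vZ := linearZ_LR (\val : {linear subalg Ygen -> Hecke n u v}) b 1.
exact: (etrans vZ (congr1 ( *:%R b) (rmorph1 rval))).
Qed.

Let map_val_mul (M N : 'M[H]_(multinom mu)) :
  map_mx val (M *m N) = map_mx val M *m map_mx val N.
Proof. exact: (map_mxM rval). Qed.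

Let map_val_scale (y : H) (M : 'M[H]_(multinom mu)) :
  map_mx val (y *: M) = val y *: map_mx val M.
Proof. exact: (map_mxZ rval). Qed.

Let map_val_delta (k j : 'I_(multinom mu)) : map_mx val (delta_mx k j) = delta_mx k j.
Proof. exact: (map_delta_mx rval). Qed.

Let map_val_inj (M N : 'M[H]_(multinom mu)) : map_mx val M = map_mx val N -> M = N.
Proof.
move=> /matrixP MN; apply/matrixP => i j; apply: (@val_inj _ _ (subalg Ygen)).
by have := MN i j; rewrite !mxE.
Qed.

(** [Psi_basis] speaks of reduced words. It is applied to the empty word and to single letters;
    multiplicativity of [Psi] then reaches all words, reduced or not. *)
Lemma Psi_Young_word (s : seq 'I_n.-1) :
  all (fun i => sadj i \in Young mu) s ->
  map_mx val (Psi (E1 * \prod_(i <- s) g i))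
    = \prod_(i <- s) T i *: delta_mx k0 k0.
Proof.
have PM x y : Psi (E1 * x * (E1 * y)) = Psi (E1 * x) *m Psi (E1 * y).
  by have := Psi_mul PsiP (E1 * x) (E1 * y); rewrite !EmuE1M.
have dd : delta_mx k0 k0 *m delta_mx k0 k0 = delta_mx k0 k0 :> 'M[Hecke n u v]_(multinom mu).
  by rewrite mul_delta_mx.
have P1 : map_mx val (Psi E1) = delta_mx k0 k0.
  have /= := Psi_basis PsiP (k := k0) (j := k0) (w := 1%g) (s := [::]) (s' := [::]).
  rewrite /g_tilde /T_tilde !big_nil expr0 invr1 !scale1r mulr1 pi_k0 !act1.
  by apply=> //; split=> //=; rewrite ?len1 // /Defs.pcomp ?invg1 ?mulg1 ?len1.
have Pg i : sadj i \in Young mu -> map_mx val (Psi (E1 * g i)) = T i *: delta_mx k0 k0.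
  move=> Yi.
  (* The two strands exchanged lie in one block, where the character is constant. *)
  have act_i : char_act (sadj i) (chi1 a0 mu) = chi1 a0 mu.
    have [a [a1 a2]] := Young_block muC Yi.
    have chi_lo : chi1 a0 mu (lo i) = a by apply: chi1E => //; rewrite /in_block /=; lia.
    have chi_hi : chi1 a0 mu (hi i) = a by apply: chi1E => //; rewrite /in_block /=; lia.
    apply/ffunP => j; rewrite ffunE /sadj tpermV.
    by case: tpermP => [->|->|//]; rewrite chi_lo.
  have /= := Psi_basis PsiP (k := k0) (j := k0) (w := sadj i) (s := [:: i]) (s' := [:: i]).
  rewrite pi_k0 !act1 => /(_ act_i (reduced_sadj i)).
  rewrite /Defs.pcomp invg1 mulg1 mul1g => /(_ (reduced_sadj i)).
  rewrite /g_tilde /T_tilde !big_seq1 /= expr1.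
  rewrite -scalerAr -[E1 * _]EmuE1M scalerAr => Pu.
  rewrite -[E1 * g i](scalerKV u_neq0) PsiZ map_val_scale valA.
  by rewrite Pu scalerA mulr_algl scalerKV.
elim: s => [_|i s IH /= /andP[Yi Ys]]; first by rewrite !big_nil mulr1 P1 scale1r.
(* Obtained from the injectivity of [Psi]: both sides have the image [T i *: delta_mx k0 k0]. *)
have E1g : E1 * g i = E1 * g i * E1.
  rewrite -[LHS]EmuE1M -[RHS](mulrA E1) -[RHS]EmuE1M; apply: (Psi_inj PsiP).
  have := PM (g i) 1; rewrite mulr1 -(mulrA E1) !EmuE1M => ->; apply: map_val_inj.
  by rewrite map_val_mul Pg // P1 -scalemxAl dd.
rewrite !big_cons mulrA E1g -mulrA PM map_val_mul Pg // IH //.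
by rewrite -scalemxAl delta_mxZr dd scalerA.
Qed.

Variables (f : {scalar Y}) (h : {scalar H}) (c : K).
Hypothesis fC : forall x y, f (x * y) = f (y * x).
Hypothesis f_word : forall s (y : H), all (fun i => sadj i \in Young mu) s ->
  val y = \prod_(i <- s) T i -> f (E1 * \prod_(i <- s) g i) = c * h y.

(** Carried to matrices, [f] becomes a trace function: it vanishes off the diagonal and takes the
    same value on [y] placed at any diagonal position. The corner at [k0] is known from words. *)
Lemma Psi_trace x : f (Emu * x) = c * h (\tr (Psi (Emu * x))).
Proof.
(* [L] chooses a preimage under [Psi]; by injectivity the value of [F] does not depend on the
   choice. *)
pose L N := projT1 (cid (Psi_surj PsiP N)).
have LK N : Psi (Emu * L N) = N by rewrite /L; case: cid.
pose F N := f (Emu * L N).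
have FE y : F (Psi (Emu * y)) = f (Emu * y).
  by congr (f _); apply: (Psi_inj PsiP); rewrite LK.
have FD M N : F (M + N) = F M + F N.
  rewrite -(LK M) -(LK N) !FE -linearD -mulrDr -FE /=; congr F.
  by have := Psi_linear PsiP 1 (L M) (L N); rewrite !scale1r => ->.
have FZ b N : F (b%:A *: N) = b * F N.
  by rewrite -(LK N) FE -linearZ /= scalerAr -FE PsiZ.
have FC M N : F (M *m N) = F (N *m M).
  rewrite -(LK M) -(LK N) -!(Psi_mul PsiP) -!(mulrA Emu) !FE.
  by rewrite !(mulrA Emu) fC.
have F0 : F 0 = 0 by rewrite -(scale0r (0 : 'M[H]_(multinom mu))) -(scale0r 1) FZ mul0r.
have Fsum (I : Type) (r : seq I) G : F (\sum_(i <- r) G i) = \sum_(i <- r) F (G i).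
  by apply: (big_morph F FD F0).
have Fdelta y k j : F (y *: delta_mx k j) = (k == j)%:R * F (y *: delta_mx k0 k0).
  have -> : y *: delta_mx k j = (y *: delta_mx k k0) *m delta_mx k0 j.
    by rewrite -scalemxAl mul_delta_mx.
  rewrite FC delta_mxZr mul_delta_mx_cond eq_sym; case: eqP => _.
    by rewrite mulr1n mul1r.
  by rewrite mulr0n scaler0 F0 mul0r.
have Fh y : F (y *: delta_mx k0 k0) = c * h y.
  (* The induction runs over elements of the ambient Hecke algebra, so a preimage [y'] in the
     subalgebra is carried along. *)
  suff [y' vy Fy] : exists2 y', val y' = val y & F (y' *: delta_mx k0 k0) = c * h y'.
    by have <- : y' = y by apply: (@val_inj _ _ (subalg Ygen)).
  have : in_subalg Ygen (val y) by apply/asboolP; apply: (valP (y : subalg Ygen)).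
  move: (val y) => w; move: w.
  apply: in_subalg_words => [s Ys|_ _ [y1 <- F1] [y2 <- F2]|b _ [y1 <- F1]].
  - have sT : \prod_(i <- s) T i \in subalg_pred Ygen.
      rewrite big_seq; apply: rpred_prod => i /(allP Ys) Yi.
      by apply/asboolP/sa_gen; exists i.
    pose y' : H := (Subalg sT : subalg Ygen); exists y' => //.
    apply: etrans (f_word (y := y') Ys erefl); rewrite -[E1 * _]EmuE1M -FE; congr F.
    by apply: map_val_inj; rewrite map_val_scale map_val_delta EmuE1M Psi_Young_word.
  - by exists (y1 + y2) => //; rewrite scalerDl FD F1 F2 linearD mulrDr.
  - exists (b *: y1) => //; rewrite -[b *: y1]mulr_algl -scalerA FZ F1.
    by rewrite mulr_algl linearZ /= mulrCA.
rewrite -FE; set M := Psi _; rewrite [in LHS](matrix_sum_delta M) Fsum /mxtrace.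
rewrite linear_sum mulr_sumr; apply: eq_bigr => k _.
rewrite Fsum (bigD1 k) //= Fdelta eqxx mul1r Fh big1 ?addr0 // => j jk.
by rewrite Fdelta eq_sym (negPf jk) mul0r.
Qed.

End PsiTrace.

(** * Scalars *)

Section Scalars.
Variables (R : realType).
Local Notation k := (kfield R).

Lemma natr_kfield_neq0 m : (0 < m)%N -> m%:R != 0 :> k.
Proof.
move=> m_gt0; rewrite -(rmorph_nat (@FracField.tofrac {poly {poly R[i]}})).
by rewrite tofrac_eq0 -!polyC_natr !polyC_eq0 Num.Theory.pnatr_eq0 -lt0n.
Qed.

Lemma sqrtq_neq0 : sqrtq R != 0.
Proof. by rewrite tofrac_eq0 polyC_eq0 polyX_eq0. Qed.

Lemma zvar_neq0 : zvar R != 0.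
Proof. by rewrite tofrac_eq0 polyX_eq0. Qed.

Lemma sqrtq_sqr_neq1 : sqrtq R ^+ 2 - 1 != 0.
Proof.
rewrite -(rmorph1 (@FracField.tofrac {poly {poly R[i]}})) -rmorphXn -rmorphB /=.
rewrite tofrac_eq0 -(rmorph1 (@polyC {poly R[i]})) -rmorphXn -rmorphB /= polyC_eq0.
by rewrite -(rmorph1 (@polyC R[i])) monic_neq0 // monicXnsubC.
Qed.

(** Multiplied by the size of [S], the numerator is a polynomial in z whose coefficient of degree 1
    is that size. *)
Lemma lambda_S_neq0 d (S : {set 'I_d}) : S != set0 -> lambda_S R S != 0.
Proof.
rewrite -card_gt0 => S_gt0.
apply: mulf_neq0; last first.
  by rewrite invr_eq0; apply: mulf_neq0; [apply/expf_neq0/sqrtq_neq0|apply: zvar_neq0].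
apply/eqP => /(congr1 ( *%R #|S|%:R)); rewrite mulr0 mulrDr mulrCA divff ?natr_kfield_neq0 //.
rewrite mulr1 => /eqP; apply/negP.
rewrite -(rmorph_nat (@FracField.tofrac {poly {poly R[i]}})).
rewrite -(rmorph1 (@FracField.tofrac {poly {poly R[i]}})) -rmorphXn -rmorphB -rmorphM -rmorphD /=.
have -> : 1 - ('X%:P) ^+ 2 = (1 - 'X ^+ 2)%:P :> {poly {poly R[i]}}.
  by rewrite polyCB polyC_exp.
rewrite tofrac_eq0 mulr_natl; apply/eqP => /polyP/(_ 1%N).
rewrite coefD coefMn coefX coefC coef0 addr0 /=.
by move/eqP; rewrite -polyC_natr polyC_eq0 Num.Theory.pnatr_eq0 -leqn0 leqNgt S_gt0.
Qed.

Lemma cst_inj : injective (@cst R).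
Proof.
move=> a b /eqP; rewrite tofrac_eq => /eqP ab.
exact: (polyC_inj (polyC_inj ab)).
Qed.

Lemma cstX a m : cst (a ^+ m) = cst a ^+ m :> k.
Proof. by rewrite /cst !rmorphXn. Qed.

End Scalars.

(** A non-empty block of size m contributes the exponent m - 1. These add up to n - r, with r the
    number of non-empty blocks, so of the n - 1 inverse factors r - 1 remain. *)
Lemma block_weights (K : fieldType) d n (mu : composition d n) (S : {set 'I_d})
    (sl z E0 : K) : mu \in Comp d n -> (0 < n)%N -> sl * z != 0 ->
  (sl * z)^-1 ^+ n.-1 * \prod_(a < d) block_weight sl z E0 S a (mu a)
    = let r := (\sum_a comp_support mu a)%N in
      if [exists a, (0 < comp_support mu a)%N && (a \notin S)] then 0
      else (sl * z)^-1 ^+ r.-1 * E0 ^+ r.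
Proof.
move=> muC n_gt0 w_neq0 /=; case: existsP => [[a /andP[]]|no].
  rewrite ffunE lt0b => mu_a aS; rewrite (bigD1 a) //= /block_weight.
  by case: (nat_of_ord (mu a)) mu_a => // m _; rewrite (negPf aS) mul0r mulr0.
have wE a : block_weight sl z E0 S a (mu a)
    = (sl * z) ^+ (mu a).-1 * E0 ^+ comp_support mu a.
  rewrite /block_weight ffunE; case E : (nat_of_ord (mu a)) => [|m] /=.
    by rewrite mulr1.
  case: ifP => [//|/negbT aS]; case: no; exists a.
  by rewrite ffunE E aS.
rewrite (eq_bigr _ (fun a _ => wE a)) big_split /= !prodrXr mulrA; congr (_ * _).
set P := (\sum_a (mu a).-1)%N; set r := (\sum_a _)%N.
have nE : n = (P + r)%N.
  move: muC; rewrite inE => /eqP <-; rewrite -big_split; apply: eq_bigr => a _.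
  by rewrite ffunE /=; case: (nat_of_ord (mu a)) => //= m; rewrite addn1.
(* A composition of a positive [n] has a non-zero part, so neither [n.-1] nor [r.-1] is
   truncated. *)
have r_gt0 : (0 < r)%N.
  rewrite lt0n; apply/negP => r0; have := r0; rewrite sum_nat_eq0 => /forall_inP mu0.
  move: n_gt0; rewrite nE (eqP r0) addn0 lt0n sum_nat_eq0 => /negP; apply.
  apply/forall_inP => a _; have := mu0 a isT.
  by rewrite ffunE; case: (nat_of_ord (mu a)).
have -> : n.-1 = (P + r.-1)%N by rewrite nE; lia.
by rewrite exprD mulrAC -exprMn mulVf // expr1n mul1r.
Qed.

(** * Assembly over all compositions *)

Theorem proposition6p13 (R : realType) (d : nat) (d_gt0 : (0 < d)%N)
    (xi : 'I_d -> R[i]) (xi_inj : injective xi)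
    (xi_root : forall a, xi a ^+ d = 1)
    (S : {set 'I_d}) (S_neq0 : S != set0)
    (kS : fieldExtType (kfield R)) (sl : kS)
    (sl_sqr : sl ^+ 2 = (lambda_S R S)%:A)
    (sl_gen : <<1; sl>>%VS = fullv) :
  let sq : kS := (sqrtq R)%:A in
  let u : kS := sq * sl in
  let v : kS := (sq ^+ 2 - 1) * sl in
  let xiS (a : 'I_d) : kS := (cst (xi a))%:A in
  forall (tr : forall n, {scalar Ytilde d n (sqrtq R ^+ 2)})
    (tr_S : juyumaya_trace (zvar R) (c_S xi S) tr)
    (trS : forall n, {scalar Ytilde d n (sq ^+ 2)})
    (trS_ext : scalar_extension tr trS)
    (tau : forall n, {scalar Hecke n u v})
    (tau_markov : hecke_markov_trace tau)
    (n : nat) (n_gt0 : (0 < n)%N)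
    (pi : forall mu : composition d n, 'I_(multinom mu) -> 'S_n)
    (pi_enum : forall mu, mu \in Comp d n -> min_reps_enum (pi mu))
    (Psi : forall mu : composition d n,
       YH d n u v -> 'M[Hecke_mu u v mu]_(multinom mu))
    (Psi_spec : forall mu, mu \in Comp d n ->
       Psi_iso xiS (Ordinal d_gt0) (pi mu) (Psi mu))
    (tau_mu : forall mu : composition d n, {scalar Hecke_mu u v mu})
    (tau_mu_spec : forall mu, mu \in Comp d n ->
       tensor_functional tau (tau_mu mu))
    (x : YH d n u v),
  rho_S trS x =
    \sum_(mu in Comp d n)
      alpha_S S sl (comp_support mu) *
      tau_mu mu (\tr (Psi mu (E_comp u v xiS mu * x))).
Proof.
move=> sq u v xiS tr tr_S trS trS_ext tau tau_markov n n_gt0 pi pi_enum Psi Psi_spec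
  tau_mu tau_mu_spec x.
pose zL : kS := (zvar R)%:A; pose E0 : kS := #|S|%:R^-1.
have algM a b : (a * b)%:A = a%:A * b%:A :> kS by exact: (rmorphM (in_alg kS)).
have algn m : m%:R%:A = m%:R :> kS by exact: (rmorph_nat (in_alg kS)).
have algX a m : (a ^+ m)%:A = a%:A ^+ m :> kS by exact: (rmorphXn (in_alg kS)).
have algV a : (a^-1)%:A = a%:A^-1 :> kS by exact: (fmorphV (in_alg kS)).
have alg0 a : (a%:A == 0 :> kS) = (a == 0) by exact: (fmorph_eq0 (in_alg kS)).
have natr_neq0 m : (0 < m)%N -> m%:R != 0 :> kS.
  by move=> m_gt0; rewrite -algn alg0 natr_kfield_neq0.
have d_neq0 := natr_neq0 _ d_gt0.
have S_gt0 : (0 < #|S|)%N by rewrite card_gt0.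
have sq_neq0 : sq != 0 by rewrite alg0 sqrtq_neq0.
have z_neq0 : zL != 0 by rewrite alg0 zvar_neq0.
have sl_neq0 : sl != 0.
  have : sl ^+ 2 != 0 by rewrite sl_sqr alg0 lambda_S_neq0.
  by rewrite expf_eq0.
have sq1 : sq ^+ 2 - 1 != 0.
  have -> : sq ^+ 2 - 1 = (sqrtq R ^+ 2 - 1)%:A by rewrite scalerBl algX scale1r.
  by rewrite alg0 sqrtq_sqr_neq1.
have u_neq0 : u != 0 by apply: mulf_neq0.
have v_neq0 : v != 0 by apply: mulf_neq0.
have xiS_inj : injective xiS.
  by move=> a b /(fmorph_inj (in_alg kS)) /cst_inj /xi_inj.
have xiS_root a : xiS a ^+ d = 1.
  by rewrite -algX -cstX xi_root /cst !polyC1 rmorph1 scale1r.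
have sl2 : sl ^+ 2 = (zL + (1 - sq ^+ 2) * E0) / (sq ^+ 2 * zL).
  rewrite sl_sqr /lambda_S algM algV algM algX scalerDl algM scalerBl scale1r algX.
  by rewrite /E_S algV algn.
(* The value of lambda_S is designed for this: it makes [1 - u ^+ 2] equal to
   [(sq ^+ 2 - 1) * E0 / zL]. *)
have E0_eq : (1 - u ^+ 2) / v = (sl * zL)^-1 * E0.
  apply: (mulIf v_neq0); rewrite divfK // exprMn sl2 /v.
  by field; rewrite sl_neq0 z_neq0 sq_neq0.
have trC := trL_sym tr_S trS_ext (n := n).
have trG (i : 'I_n.-1) y : y \in Ysub i.+1 -> trS n (y * YtildeG d (sq ^+ 2) i) = zL * trS n y.
  by move=> /asboolP sy; apply: (trL_G tr_S trS_ext).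
have c_SE b : (c_S xi S b)%:A = E0 * \sum_(a in S) xiS a ^+ b.
  rewrite /c_S algM algV algn scaler_suml; congr (_ * _).
  by apply: eq_bigr => a _; rewrite algX.
(* Once the projector is expanded, the parameters [c_S] combine with the powers of [xiS a] into the
   sums of [root_sum], of which only the term [b = a] survives, present exactly when [a] lies in
   [S]. *)
have trP a j y : (j < n)%N -> y \in Ysub j ->
    trS n (y * tidem n sq xiS a j) = (if a \in S then E0 else 0) * trS n y.
  move=> jn sy; rewrite tidemE /cyc_idem -scalerAr linearZ mulr_sumr linear_sum /=.
  have trX (s : 'I_d) : trS n (y * (xiS a ^+ s *: Ytildet d (sq ^+ 2) (Ordinal jn) ^+ (d - s)))
      = \sum_(b in S) (xiS a ^+ s * xiS b ^+ (d - s)) * (E0 * trS n y).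
    rewrite -mulr_suml -mulr_sumr -scalerAr linearZ /= -!mulrA; congr (_ * _).
    rewrite mulrA -[_ * E0]mulrC -c_SE.
    (* At [s = 0] the exponent is [d], outside the range of the trace rule; there the power of t is
       1, and so is [c_S] at [d]. *)
    have [s0|s_gt0] := posnP s; last first.
      by apply: (trL_t tr_S trS_ext); [lia|apply/asboolP].
    rewrite s0 subn0 c_SE; have [[_ _ _ ->] _] := YtildeP d n (sq ^+ 2).
    rewrite mulr1 (eq_bigr (fun=> 1)) => [|b _]; last exact: xiS_root.
    by rewrite sumr_const mulVf ?mul1r // natr_neq0.
  rewrite (eq_bigr _ (fun s _ => trX s)) exchange_big /=.
  under eq_bigr => b _ do rewrite -mulr_suml root_sum //.
  rewrite -mulr_suml -mulr_suml -[_ * d%:R * _]mulrA mulrCA mulKf // mulrA.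
  congr (_ * _); case: ifP => aS.
    rewrite (bigD1 a) //= eqxx big1 ?addr0 ?mul1r // => b /andP[_ ba].
    by rewrite eq_sym (negPf ba).
  rewrite big1 ?mul0r // => b bS; case: eqP => // ab.
  by rewrite -ab aS in bS.
pose phi := @YH_to_Ytildem kS d n sq sl d_neq0.
pose f : {scalar YH d n u v} := trS n \o phi.
have phi_t j : phi (@YHt kS d n u v j) = Ytildet d (sq ^+ 2) j by apply: pliftm_gen.
have phi_g i : phi (@YHg kS d n u v i) = hgen d sq sl i by apply: pliftm_gen.
have f_block mu : mu \in Comp d n -> f (E_comp u v xiS mu * x)
    = (\prod_(a < d) block_weight sl zL E0 S a (mu a))
      * tau_mu mu (\tr (Psi mu (E_comp u v xiS mu * x))).
  move=> muC; have [k0 pi_k0] := pi1_ex (pi_enum mu muC).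
  apply: (Psi_trace d_neq0 xiS_inj xiS_root u_neq0 muC (Psi_spec mu muC) pi_k0).
    by move=> y1 y2; rewrite /f /= !rmorphM trC.
  move=> s y sY yE.
  have tr1 := trL_one tr_S trS_ext n.
  rewrite -(Young_word_trace d_neq0 xiS_inj xiS_root muC trC tr1 trG trP tau_markov
    u_neq0 v_neq0 z_neq0 E0_eq (Ordinal d_gt0) (tau_mu_spec mu muC) sY yE).
  rewrite /f /= rmorphM !rmorph_prod; congr (trS n (_ * _)).
    by apply: eq_bigr => j _; rewrite [LHS]cyc_idem_morph phi_t.
  by apply: eq_bigr => i _; apply: phi_g.
(* The unit is split into the idempotents [E_comp] and each summand is evaluated by [f_block]; the
   power of [D_S] is then merged with the weights. *)
rewrite /rho_S YH_to_YtildeE -/phi -[trS n (phi x)]/(f x) -[in LHS](mul1r x).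
rewrite -(E_comp_sum n u v d_neq0 xiS_inj xiS_root d_gt0) mulr_suml linear_sum mulr_sumr.
apply: eq_bigr => mu muC; rewrite f_block // mulrA; congr (_ * _).
rewrite block_weights // ?mulf_neq0 // /alpha_S.
by case: ifP => // _; rewrite [E0 ^+ _]exprVn.
Qed.
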